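(* Let $\mathcal{X}$ be a real vector space and $\mathcal{C}$ a family of subsets of $\mathcal{X}$ such that every $C\in\mathcal{C}$ is a symmetric, algebraically open, convex set containing $0$ for which the locally convex topology $\tau_C$ generated by $C$ is separable. Let $\tau(\mathcal{C})$ be the locally convex topology on $\mathcal{X}$ for which $\mathcal{C}_0$ is a local basis at $0$, and $\mathcal{F}(\mathcal{C})=\sigma\big(\bigcup_{x\in\mathcal{X}}\mathcal{C}_x\big)$. Let $(X_n)_{n\ge1}$ be a sequence of independent and identically distributed $(\mathcal{X},\mathcal{F}(\mathcal{C}))$-valued random variables and $\overline{X}_n=(X_1+\dots+X_n)/n$. Then $(\overline{X}_n,n)_{n\ge1}$ satisfies a weak large deviation principle, and its entropy satisfies $s=-p^*$, where $p(\lambda)=\log\mathbb{E}(e^{\lambda(X_1)})$ for $\lambda\in\mathcal{X}^*$.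
   Context: A set $C\subset\mathcal{X}$ is algebraically open if for every $x\in C$ and $y\in\mathcal{X}$ there is $\varepsilon>0$ with $x+ty\in C$ for $|t|<\varepsilon$; $\tau_C$ is the topology of the Minkowski seminorm $M_C$. For $x\in\mathcal{X}$, $\mathcal{C}_x=\{x+\bigcap_{i=1}^r\lambda_iC_i : r\ge0,\ C_i\in\mathcal{C},\ \lambda_i>0\}$ (a local basis of measurable neighborhoods of $x$). $\mathcal{X}^*$ is the dual of $(\mathcal{X},\tau(\mathcal{C}))$ (its elements are measurable, and $\overline{X}_n$ is measurable). Entropy: $s(x)=\inf_{V\in\mathcal{C}_x}\liminf_n\frac1n\log\mathbb{P}(\overline{X}_n\in V)$. $p^*(x)=\sup_{\lambda\in\mathcal{X}^*}(\lambda(x)-p(\lambda))$. Weak large deviation principle: (i) for every $G\in\mathcal{F}(\mathcal{C})$, $\liminf_n\frac1n\log\mathbb{P}(\overline{X}_n\in G)\ge\sup_{x\in\mathrm{int}\,G}s(x)$; (ii) for every relatively compact $K\in\mathcal{F}(\mathcal{C})$ (compact meaning every open cover has a finite subcover), $\limsup_n\frac1n\log\mathbb{P}(\overline{X}_n\in K)\le\sup_{x\in\overline{K}}s(x)$. *)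

(* Defs.v *)
From HB Require Import structures.
From mathcomp Require Import all_boot all_order all_algebra.
From mathcomp Require Import all_classical all_reals all_analysis.
Set Implicit Arguments. Unset Strict Implicit. Unset Printing Implicit Defensive.
Import Order.TTheory GRing.Theory Num.Theory.
Import numFieldNormedType.Exports.
Local Open Scope classical_set_scope.
Local Open Scope ring_scope.

Section VectorDefs.
Context {R : realType} {X : lmodType R}.
Implicit Types (C A G V : set X) (Cs : set (set X)).

Definition scale_set (l : R) C : set X := [set l *: c | c in C].
Definition translate_set (x : X) A : set X := [set x + a | a in A].

Definition symmetric_set C := forall x, C x -> C (- x).
Definition algebraically_open C :=
  forall x y, C x -> exists2 e : R, 0 < e & forall t : R, `|t| < e -> C (x + t *: y).
Definition is_convex_set C :=
  forall x y (t : R), C x -> C y -> 0 <= t <= 1 -> C ((1 - t) *: x + t *: y).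

Definition minkowski C (x : X) : R := inf [set t : R | 0 < t /\ scale_set t C x].

(* tau_C (topology of the seminorm M_C) is separable: it has a countable dense set *)
Definition tau_separable C :=
  exists D : set X, countable D /\
    forall x (e : R), 0 < e -> exists2 d, D d & minkowski C (x - d) < e.

Definition nbhd_basis Cs (x : X) : set (set X) :=
  [set V | exists (r : nat) (Ci : nat -> set X) (l : nat -> R),
     (forall i, (i < r)%N -> Cs (Ci i) /\ 0 < l i) /\
     V = translate_set x (\bigcap_(i in `I_r) scale_set (l i) (Ci i))].

Definition tauC_open Cs G := forall x, G x -> exists2 V, nbhd_basis Cs x V & V `<=` G.
Definition tauC_interior Cs G : set X :=
  [set x | exists2 V, nbhd_basis Cs x V & V `<=` G].
Definition tauC_closure Cs A : set X :=
  [set x | forall V, nbhd_basis Cs x V -> V `&` A !=set0].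
Definition tauC_compact Cs A :=
  forall O : set (set X), O `<=` tauC_open Cs -> A `<=` \bigcup_(U in O) U ->
    exists (n : nat) (U : nat -> set X),
      (forall i, (i < n)%N -> O (U i)) /\ A `<=` \bigcup_(i in `I_n) U i.

Definition F_C Cs : set (set X) := <<s [set V | exists x, nbhd_basis Cs x V] >>.

Definition dual_space Cs : set (X -> R) :=
  [set lam | (forall (a : R) (x y : X), lam (a *: x + y) = a * lam x + lam y) /\
             (forall U : set R, open U -> tauC_open Cs (lam @^-1` U))].
End VectorDefs.

Section ProbDefs.
Context {R : realType} {X : lmodType R} {d : measure_display} {Omega : measurableType d}.
Variable P : probability Omega R.
Implicit Types (Cs : set (set X)) (Y : nat -> Omega -> X).

Definition mean_seq Y (n : nat) : Omega -> X :=
  fun w => (n%:R)^-1 *: \sum_(i < n) Y i w.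

Definition rv_measurable (F : set (set X)) (Z : Omega -> X) :=
  forall A, F A -> measurable (Z @^-1` A).

Definition iid (F : set (set X)) Y :=
  [/\ (forall n, rv_measurable F (Y n)),
      (forall n A, F A -> P (Y n @^-1` A) = P (Y 0%N @^-1` A)) &
      (forall (s : seq nat) (A : nat -> set X), uniq s -> (forall i, F (A i)) ->
         P (\bigcap_(i in [set` s]) (Y i @^-1` A i)) =
         (\prod_(i <- s) P (Y i @^-1` A i))%E)].

Definition log_prob_seq Y (V : set X) : (\bar R)^nat :=
  fun n => (((n%:R)^-1)%:E * lne (P (mean_seq Y n @^-1` V)))%E.

Definition entropy Cs Y (x : X) : \bar R :=
  ereal_inf [set limn_einf (log_prob_seq Y V) | V in nbhd_basis Cs x].

Definition logmgf Y (lam : X -> R) : \bar R :=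
  lne (\int[P]_w (expR (lam (Y 0%N w)))%:E).

Definition legendre Cs Y (x : X) : \bar R :=
  ereal_sup [set ((lam x)%:E - logmgf Y lam)%E | lam in dual_space Cs].

Definition weak_LDP Cs Y :=
  (forall G, F_C Cs G ->
     (ereal_sup (entropy Cs Y @` tauC_interior Cs G) <= limn_einf (log_prob_seq Y G))%E) /\
  (forall K, F_C Cs K -> tauC_compact Cs (tauC_closure Cs K) ->
     (limn_esup (log_prob_seq Y K) <= ereal_sup (entropy Cs Y @` tauC_closure Cs K))%E).
End ProbDefs.

(* Main.v *)
Require Import Defs.
From HB Require Import structures.
From mathcomp Require Import all_boot all_order all_algebra.
From mathcomp Require Import all_classical all_reals all_analysis.
From mathcomp Require Import measurable_realfun.
From mathcomp Require Import ring lra.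
(** Every basic neighbourhood is a ball of a separable seminorm [N], and a dual form is
    a linear form bounded by such an [N].  A countable [N]-dense set cuts the space into
    cells of diameter [2 * dl], which replaces the sample by words over a countable
    alphabet, up to an error [dl]; truncating the alphabet leaves sums over finite words.

    Concatenating words shows that the probabilities that the mean lies in a ball are
    supermultiplicative, so a liminf rate below [b] bounds them by [expR b ^+ m] for all
    [m]: this gives the upper bound on compact sets.  Conversely, if the ball of radius
    [r] at [x] has probability at most [expR (- a) ^+ m] for all [m], then some form of
    dual norm at most [a / r] satisfies [p lam <= lam x - a + eps].  On a finite alphabet
    it is a minimiser of the exponential moment over the dual ball: by Hahn-Banach
    it is extremal at the barycenter of the tilted weights, and one concludes by Jensen's
    inequality or by the tilted law of large numbers.  Compactness of the dual ball then
    removes the truncation. *)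

Set Implicit Arguments. Unset Strict Implicit. Unset Printing Implicit Defensive.
Import Order.TTheory GRing.Theory Num.Theory.
Import numFieldNormedType.Exports.
Local Open Scope classical_set_scope.
Local Open Scope ring_scope.

(** * Sublinear functionals and the Hahn-Banach theorem *)

Section Sublinear.
Context {R : realType} {X : lmodType R}.
Implicit Types (p N : X -> R) (x y z : X).

Definition sublinear p :=
  (forall x y, p (x + y) <= p x + p y) /\
  (forall t x, 0 <= t -> p (t *: x) = t * p x).

Definition seminorm N :=
  (forall x y, N (x + y) <= N x + N y) /\ (forall t x, N (t *: x) = `|t| * N x).

Lemma sublinear0 p : sublinear p -> p 0 = 0.
Proof. by case=> _ h; rewrite -(scale0r 0) h ?mul0r. Qed.

Lemma sublinear_oppr_ge p x : sublinear p -> - p (- x) <= p x.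
Proof.
move=> ps; have := sublinear0 ps; rewrite -(subrr x) => h0.
by have := ps.1 x (- x); rewrite h0 -lerBlDr sub0r.
Qed.

(** The classical Hahn-Banach perturbation: it stays below [p], and [t = 1] at the point [- z]
    bounds it there by [- p z], so that [z] becomes a direction of linearity. *)
Definition tilt p z x : R := inf [set p (x + t *: z) - t * p z | t in [set t | 0 <= t]].

Lemma tilt_lb p z x t : sublinear p -> 0 <= t ->
  - p (- x) <= p (x + t *: z) - t * p z.
Proof.
move=> ps t0; rewrite -ps.2//.
by have := ps.1 (x + t *: z) (- x); rewrite [x + t *: z]addrC addrK; lra.
Qed.

Lemma has_inf_tilt p z x : sublinear p ->
  has_inf [set p (x + t *: z) - t * p z | t in [set t | 0 <= t]].
Proof.
move=> ps; split; first by exists (p (x + 0 *: z) - 0 * p z), 0 => /=.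
by exists (- p (- x)) => _ [t t0 <-]; exact: tilt_lb.
Qed.

Lemma tilt_le p z x t : sublinear p -> 0 <= t -> tilt p z x <= p (x + t *: z) - t * p z.
Proof. by move=> ps t0; apply: ge_inf; [case: (has_inf_tilt z x ps)|exists t]. Qed.

Lemma tilt_le_id p z x : sublinear p -> tilt p z x <= p x.
Proof.
move=> ps; have := tilt_le z x ps (lexx 0).
by rewrite scale0r addr0 mul0r subr0.
Qed.

(** If [s] and [t] are nearly optimal for [x] and [y], then [s + t] is a good parameter for [x + y].
    For homogeneity the parameter is rescaled, and the reverse inequality is the direct one for
    [t^-1]. *)
Lemma sublinear_tilt p z : sublinear p -> sublinear (tilt p z).
Proof.
move=> ps; have [pD pZ] := ps.
have tiltD x y : tilt p z (x + y) <= tilt p z x + tilt p z y.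
  apply/ler_addgt0Pr => e e0.
  have e20 : 0 < e / 2 by rewrite divr_gt0.
  have [_ [s s0 <-] hs] := inf_adherent e20 (has_inf_tilt z x ps).
  have [_ [t t0 <-] ht] := inf_adherent e20 (has_inf_tilt z y ps).
  apply: (le_trans (tilt_le z (x + y) ps (addr_ge0 s0 t0))).
  have -> : x + y + (s + t) *: z = (x + s *: z) + (y + t *: z).
    by rewrite scalerDl addrACA.
  have := pD (x + s *: z) (y + t *: z).
  rewrite /tilt; move: hs ht; set a := inf _; set b := inf _; nra.
have tiltZ_le t x : 0 < t -> tilt p z (t *: x) <= t * tilt p z x.
  move=> t0; apply/ler_addgt0Pr => e e0.
  have et0 : 0 < e / t by rewrite divr_gt0.
  have [_ [s s0 <-] hs] := inf_adherent et0 (has_inf_tilt z x ps).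
  apply: (le_trans (tilt_le z (t *: x) ps (mulr_ge0 (ltW t0) s0))).
  rewrite -scalerA -scalerDr (pZ _ _ (ltW t0)) -mulrA -mulrBr.
  apply: (@le_trans _ _ (t * (tilt p z x + e / t))); first by rewrite ler_pM2l// ltW.
  by rewrite mulrDr mulrCA divff ?mulr1// gt_eqF.
split=> // t x; rewrite le_eqVlt => /predU1P[<-|t0].
  rewrite scale0r mul0r; apply/eqP; rewrite eq_le.
  rewrite (le_trans (tilt_le_id z 0 ps)) ?(sublinear0 ps)//=.
  apply: lb_le_inf; first by case: (has_inf_tilt z 0 ps).
  by move=> _ [s s0 <-]; have := tilt_lb z 0 ps s0; rewrite oppr0 sublinear0// oppr0.
apply/eqP; rewrite eq_le tiltZ_le//=.
have ti0 : 0 < t^-1 by rewrite invr_gt0.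
have := tiltZ_le _ (t *: x) ti0; rewrite scalerA mulVf ?gt_eqF// scale1r.
by rewrite ler_pdivlMl.
Qed.

(** Minimality forces [tilt p y = p]; the bound of the tilt at [t = 1] then reads as
    superadditivity. *)
Lemma minimal_sublinear_linear p : sublinear p ->
  (forall q, sublinear q -> (forall x, q x <= p x) -> q = p) ->
  forall a x y, p (a *: x + y) = a * p x + p y.
Proof.
move=> ps pmin; have [pD pZ] := ps.
have padd x y : p (x + y) = p x + p y.
  apply/eqP; rewrite eq_le pD /= -lerBrDr.
  have {1}<- := pmin _ (sublinear_tilt y ps) (fun x => tilt_le_id y x ps).
  by have := tilt_le y x ps ler01; rewrite scale1r mul1r.
have popp x : p (- x) = - p x.
  by apply/eqP; rewrite -addr_eq0 -padd addNr; apply/eqP; exact: sublinear0.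
move=> a x y; rewrite padd; congr (_ + _).
have [a0|a0] := leP 0 a; first exact: pZ.
by rewrite -[a in LHS]opprK scaleNr popp pZ ?mulNr ?opprK// oppr_ge0 ltW.
Qed.

(* A minimal sublinear functional below [N] is linear, because it is unchanged by [tilt]. *)
Lemma linear_below_sublinear N : sublinear N ->
  exists2 mu : X -> R, (forall a x y, mu (a *: x + y) = a * mu x + mu y) &
    forall x, mu x <= N x.
Proof.
move=> Ns.
pose T := {p : X -> R | sublinear p /\ forall x, p x <= N x}.
(* The order is reversed: a maximal element for Zorn's lemma is a minimal functional. *)
pose below (p q : T) := `[< forall x, sval q x <= sval p x >].
(* A lower bound common to all elements keeps the pointwise infimum of a chain finite. *)
have Tlb (p : T) x : - N (- x) <= sval p x.
  case: p => p [ps pN] /=; apply: le_trans (sublinear_oppr_ge x ps).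
  by rewrite lerN2.
have [|||A tot|p pmax] := @Zorn T below.
- by move=> p; apply/asboolP.
- move=> p q r /asboolP pq /asboolP qr; apply/asboolP => x.
  exact: le_trans (qr x) (pq x).
- move=> [p pp] [q qq] /asboolP pq /asboolP qp; apply: eq_exist.
  by apply/funext => x; apply/eqP; rewrite eq_le; apply/andP.
- have [[p0 Ap0]|A0] := pselect (A !=set0); last first.
    by exists (exist _ N (conj Ns (fun x => lexx (N x))) : T) => p Ap; case: A0; exists p.
  pose E x := [set sval p x | p in A].
  have hE x : has_inf (E x).
    split; first by exists (sval p0 x), p0.
    by exists (- N (- x)) => _ [p _ <-]; exact: Tlb.
  have Ele (p : T) x : A p -> inf (E x) <= sval p x.
    by move=> Ap; apply: ge_inf; [case: (hE x)|exists p].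
  suff s : sublinear (fun x => inf (E x)) /\ forall x, inf (E x) <= N x.
    by exists (exist _ (fun x => inf (E x)) s : T) => p Ap; apply/asboolP => x /=; exact: Ele.
  split; last by move=> x; apply: le_trans (Ele _ x Ap0) _; exact: (svalP p0).2.
  have EZ t x : 0 < t -> inf (E (t *: x)) <= t * inf (E x).
    move=> t0; rewrite -ler_pdivrMl//; apply: lb_le_inf; first by case: (hE x).
    move=> _ [p Ap <-]; rewrite ler_pdivrMl// -((svalP p).1.2 _ _ (ltW t0)).
    exact: Ele.
  split=> [x y|t x].
    apply/ler_addgt0Pr => e e0.
    have e20 : 0 < e / 2 by rewrite divr_gt0.
    have [_ [p Ap <-] hp] := inf_adherent e20 (hE x).
    have [_ [q Aq <-] hq] := inf_adherent e20 (hE y).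
    (* Totality of the chain yields one functional that is nearly optimal at both points. *)
    have [r Ar [rx ry]] : exists2 r, A r & sval r x <= sval p x /\ sval r y <= sval q y.
      by have [/asboolP h|/asboolP h] := tot p q Ap Aq; [exists q|exists p].
    have := Ele r (x + y) Ar; have := (svalP r).1.1 x y; lra.
  rewrite le_eqVlt => /orP[/eqP<-|t0].
    rewrite scale0r mul0r; have -> : E 0 = [set 0].
      apply/seteqP; split=> [_ [p _ <-]|_ ->] /=; first exact: sublinear0 (svalP p).1.
      by exists p0 => //; exact: sublinear0 (svalP p0).1.
    by rewrite inf1.
  apply/eqP; rewrite eq_le EZ//=.
  have ti0 : 0 < t^-1 by rewrite invr_gt0.
  have := EZ _ (t *: x) ti0; rewrite scalerA mulVf ?gt_eqF// scale1r.
  by rewrite ler_pdivlMl.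
exists (sval p); last exact: (svalP p).2.
apply: minimal_sublinear_linear (svalP p).1 _ => q qs qp.
have qN : sublinear q /\ forall x, q x <= N x.
  by split=> // x; exact: le_trans (qp x) ((svalP p).2 x).
have <- // : (exist _ q qN : T) = p by apply: pmax; apply/asboolP.
Qed.

Lemma seminorm_sublinear N : seminorm N -> sublinear N.
Proof. by case=> ND NZ; split=> // t x t0; rewrite NZ ger0_norm. Qed.

Lemma seminormN N x : seminorm N -> N (- x) = N x.
Proof. by case=> _ h; rewrite -scaleN1r h normrN1 mul1r. Qed.

Lemma seminorm_ge0 N x : seminorm N -> 0 <= N x.
Proof.
move=> Ns; have := sublinear_oppr_ge x (seminorm_sublinear Ns).
by rewrite seminormN//; lra.
Qed.

(** A linear form below the tilt of [N] along [- z] is at most [N (z - z) - N (- z) = - N z] at [z],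
    and being below [N] it cannot be smaller there. *)
Lemma hahn_banach_supporting N z : seminorm N ->
  exists2 mu : X -> R, (forall a x y, mu (a *: x + y) = a * mu x + mu y) &
    (forall x, `|mu x| <= N x) /\ mu z = - N z.
Proof.
move=> Ns; have Nsub := seminorm_sublinear Ns.
have [mu lmu mule] := linear_below_sublinear (sublinear_tilt (- z) Nsub).
have mu0 : mu 0 = 0 by have := lmu 1 0 0; rewrite scaler0 addr0; lra.
have muN x : mu (- x) = - mu x.
  by have := lmu (-1) x 0; rewrite addr0 scaleN1r mu0; lra.
have muN1 x : mu x <= N x := le_trans (mule x) (tilt_le_id _ _ Nsub).
exists mu => //; split=> [x|].
  by rewrite ler_norml muN1 lerNl -muN andbT -[leRHS](seminormN _ Ns).
apply/eqP; rewrite eq_le; apply/andP; split.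
  apply: le_trans (mule z) _; have := tilt_le (- z) z Nsub ler01.
  by rewrite scale1r subrr (sublinear0 Nsub) mul1r (seminormN _ Ns) sub0r.
by rewrite lerNl -muN -[leRHS](seminormN _ Ns).
Qed.

End Sublinear.

(** * Integration over finite words *)

Section WordExpectation.
Context {R : realType}.
Implicit Types (q g h : nat -> R) (k m n : nat) (f : seq nat -> R) (w : seq nat).

(* Integral of [f] over the words of length [m] in the letters [0, ..., k - 1]
   for the product of the measure with weights [q]. *)
Fixpoint wordE q k m f : R :=
  if m is m'.+1 then \sum_(j < k) q j * wordE q k m' (fun w => f ((j : nat) :: w))
  else f [::].

Definition word k m w := (size w == m) && all (fun j => (j < k)%N) w.

Lemma le_wordE q k m f f' : (forall j, 0 <= q j) ->
  (forall w, word k m w -> f w <= f' w) -> wordE q k m f <= wordE q k m f'.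
Proof.
move=> q0; elim: m f f' => [|m IH] f f' ff /=; first exact: ff.
apply: ler_sum => j _; apply: ler_wpM2l => //; apply: IH => w /andP[sw aw].
by apply: ff; rewrite /word /= eqSS sw ltn_ord.
Qed.

Lemma eq_wordE q k m f f' :
  (forall w, word k m w -> f w = f' w) -> wordE q k m f = wordE q k m f'.
Proof.
elim: m f f' => [|m IH] f f' ff /=; first exact: ff.
apply: eq_bigr => j _; congr (_ * _); apply: IH => w /andP[sw aw].
by apply: ff; rewrite /word /= eqSS sw ltn_ord.
Qed.

Lemma wordE_ge0 q k m f : (forall j, 0 <= q j) -> (forall w, 0 <= f w) ->
  0 <= wordE q k m f.
Proof.
move=> q0; elim: m f => [|m IH] f f0 //=.
by apply: sumr_ge0 => j _; rewrite mulr_ge0// IH.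
Qed.

Lemma wordEZ q k m c f : wordE q k m (fun w => c * f w) = c * wordE q k m f.
Proof.
elim: m f => //= m IH f; rewrite mulr_sumr.
by apply: eq_bigr => j _; rewrite IH mulrCA.
Qed.

Lemma wordED q k m f f' :
  wordE q k m (fun w => f w + f' w) = wordE q k m f + wordE q k m f'.
Proof.
elim: m f f' => //= m IH f f'; rewrite -big_split /=.
by apply: eq_bigr => j _; rewrite IH mulrDr.
Qed.

Lemma wordE0 q k m : wordE q k m (fun=> 0) = 0.
Proof. by elim: m => //= m IH; rewrite big1// => j _; rewrite IH mulr0. Qed.

Lemma wordE_sum q k m (n : nat) (F : nat -> seq nat -> R) :
  wordE q k m (fun w => \sum_(i < n) F i w) = \sum_(i < n) wordE q k m (F i).
Proof.
elim: n => [|n IH].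
  rewrite big_ord0 -[RHS](wordE0 q k m).
  by apply: eq_wordE => w _; rewrite big_ord0.
rewrite big_ord_recr /= -IH -wordED; apply: eq_wordE => w _.
by rewrite big_ord_recr.
Qed.

Lemma wordE_cat q k m n f :
  wordE q k (m + n) f = wordE q k m (fun u => wordE q k n (fun v => f (u ++ v))).
Proof. by elim: m f => //= m IH f; apply: eq_bigr => j _; rewrite IH. Qed.

(** Change of measure: a density on letters becomes its product along the word. It serves for
    exponential tilting and for Chernoff's bound. *)
Lemma wordE_reweight q g k m f :
  wordE (fun j => q j * g j) k m f = wordE q k m (fun w => (\prod_(j <- w) g j) * f w).
Proof.
elim: m f => [|m IH] f /=; first by rewrite big_nil mul1r.
apply: eq_bigr => j _; rewrite IH -mulrA -wordEZ; congr (_ * _).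
by apply: eq_wordE => w _; rewrite big_cons mulrA.
Qed.

Lemma wordE1 q k m : wordE q k m (fun=> 1) = (\sum_(j < k) q j) ^+ m.
Proof.
elim: m => [|m IH] /=; first by rewrite expr0.
by rewrite exprS mulr_suml; apply: eq_bigr => j _; rewrite IH.
Qed.

(** Second moment of a centered random walk; the free starting point [s] is what the induction on
    the first letter needs. *)
Lemma wordE_square q k m h (s : R) : \sum_(j < k) q j = 1 ->
  \sum_(j < k) q j * h j = 0 ->
  wordE q k m (fun w => (s + \sum_(j <- w) h j) ^+ 2) =
  s ^+ 2 + m%:R * \sum_(j < k) q j * h j ^+ 2.
Proof.
move=> q1 h0; elim: m s => [|m IH] s /=.
  by rewrite big_nil addr0 mul0r addr0.
under eq_bigr => j _.
  under eq_fun => w do rewrite big_cons addrA.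
  rewrite IH; set D := \sum_(i < k) _.
  rewrite (_ : q j * _ = q j * (s ^+ 2 + m%:R * D) + 2 * s * (q j * h j) +
    q j * h j ^+ 2); last by ring.
  over.
rewrite !big_split /= -mulr_suml -mulr_sumr q1 h0 -natr1; ring.
Qed.

(** * The weak law of large numbers for a seminorm *)

Section LargeNumbers.
Context {X : lmodType R} (N : X -> R) (v : nat -> X) (q : nat -> R) (k : nat).
Hypotheses (Ns : seminorm N) (q0 : forall j, 0 <= q j) (q1 : \sum_(j < k) q j = 1).
Let z := \sum_(j < k) q j *: v j.
Let dev (i j : nat) : R := (j == i)%:R - q i.

(** The fluctuation of the vector sum is expanded along the finitely many [v i], with the deviations
    of the letter counts as coefficients; this reduces the law of large numbers to scalar
    variances. *)
Let centered (w : seq nat) : all (fun j => (j < k)%N) w ->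
  \sum_(j <- w) v j - (size w)%:R *: z = \sum_(i < k) (\sum_(j <- w) dev i j) *: v i.
Proof.
elim: w => [_|j w IH /= /andP[jk aw]].
  rewrite big_nil scale0r subr0 big1// => i _.
  by rewrite big_nil scale0r.
rewrite big_cons -nat1r scalerDl scale1r opprD addrACA IH//.
under [in RHS]eq_bigr => i _ do rewrite big_cons scalerDl.
rewrite big_split /=; congr (_ + _).
under eq_bigr => i _ do rewrite scalerBl.
rewrite sumrB; congr (_ - _).
rewrite (bigD1 (Ordinal jk)) //= eqxx scale1r big1 ?addr0// => i /negPf ij.
by rewrite [j == i](_ : _ = false) ?scale0r// eq_sym; exact: ij.
Qed.

Let variance i m : (i < k)%N ->
  wordE q k m (fun w => (\sum_(j <- w) dev i j) ^+ 2) <= m%:R.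
Proof.
move=> ik; have dev0 : \sum_(j < k) q j * dev i j = 0.
  under eq_bigr => j _ do rewrite mulrBr.
  rewrite sumrB -mulr_suml q1 mul1r (bigD1 (Ordinal ik)) //= eqxx mulr1.
  rewrite big1 ?addr0 ?subrr// => j ji.
  by rewrite [_ == i](_ : _ = false) ?mulr0//; apply/negbTE.
have qi1 : q i <= 1.
  rewrite -q1 (bigD1 (Ordinal ik)) //= lerDl; exact: sumr_ge0.
have := @wordE_square q k m (dev i) 0 q1 dev0.
under eq_wordE => w _ do rewrite add0r.
move=> ->; rewrite expr0n add0r ler_piMr// -[leRHS]q1.
apply: ler_sum => j _; rewrite ler_piMr//.
by rewrite /dev; have := q0 i; case: (_ == _) => qi0; rewrite expr2 /=; nra.
Qed.

Lemma weak_law_large_numbers (e : R) : 0 < e ->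
  exists m0, forall m, (m0 <= m)%N ->
    1 / 2 <= wordE q k m (fun w => (N (\sum_(j <- w) v j - m%:R *: z) < m%:R * e)%R%:R).
Proof.
move=> e0; pose L := \sum_(i < k) N (v i).
have L0 : 0 <= L by apply: sumr_ge0 => i _; exact: seminorm_ge0.
(* Parameter of the inequality [|c| <= t c^2 / 2 + 1 / (2 t)], tuned so that the two resulting
   contributions to the failure probability are at most 1/4 each for large [m]; the [+ 1] covers
   [L = 0]. *)
pose t := e / (2 * (L + 1)).
have t0 : 0 < t by rewrite divr_gt0// mulr_gt0// ltr_wpDl.
exists (Num.truncn (2 * L / (t * e))).+1 => m mm0.
have m0 : 0 < m%:R :> R by rewrite ltr0n (leq_trans _ mm0).
have mL : 2 * L / (t * e) <= m%:R.
  by apply/ltW/(lt_le_trans (truncnS_gt _)); rewrite ler_nat.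
have me : 0 < m%:R * e by rewrite mulr_gt0.
(* A majorant of the indicator of failure that is quadratic in the deviations, as in Chebyshev's
   inequality. *)
pose A (w : seq nat) := \sum_(i < k) N (v i) / (m%:R * e) *
  ((t / 2) * (\sum_(j <- w) dev i j) ^+ 2 + (2 * t)^-1).
have Aw w : word k m w ->
  1 + -1 * A w <= (N (\sum_(j <- w) v j - m%:R *: z) < m%:R * e)%R%:R.
  move=> /andP[/eqP sw aw]; have [_|] := ltP; rewrite ?mulN1r.
    rewrite gerDl oppr_le0; apply: sumr_ge0 => i _.
    apply: mulr_ge0; first by apply: divr_ge0; [exact: seminorm_ge0|exact: ltW].
    apply: addr_ge0; first by apply: mulr_ge0; [rewrite divr_ge0// ltW|exact: sqr_ge0].
    by rewrite invr_ge0 mulr_ge0// ltW.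
  rewrite -sw centered// => hN; rewrite subr_le0.
  rewrite sw in hN; rewrite -(ler_pM2l me) mulr1; apply: (le_trans hN).
  have [ND NZ] := Ns.
  have Nsum (F : nat -> X) n : N (\sum_(i < n) F i) <= \sum_(i < n) N (F i).
    elim: n => [|n IH]; first by rewrite !big_ord0 (sublinear0 (seminorm_sublinear Ns)).
    by rewrite !big_ord_recr /=; apply: le_trans (ND _ _) _; rewrite lerD2r.
  apply: (le_trans (Nsum (fun i => (\sum_(j <- w) dev i j) *: v i) k)).
  rewrite mulr_sumr; apply: ler_sum => i _; rewrite NZ.
  rewrite mulrA [_ * (_ / _)]mulrC divfK ?gt_eqF// mulrC.
  apply: ler_wpM2l; first exact: seminorm_ge0.
  set c := \sum_(j <- w) _.
  rewrite -(real_normK (num_real c)).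
  (* Completing the square. *)
  rewrite [leRHS](_ : _ = `|c| + (t * `|c| - 1) ^+ 2 / (2 * t)); last first.
    by field; rewrite gt_eqF.
  by rewrite lerDl divr_ge0 ?sqr_ge0// mulr_ge0// ltW.
apply: (le_trans _ (le_wordE q0 Aw)).
rewrite wordED wordEZ wordE1 q1 expr1n.
suff : wordE q k m A <= 1 / 2 by lra.
rewrite /A (@wordE_sum q k m k (fun i w => N (v i) / (m%:R * e) *
  ((t / 2) * (\sum_(j <- w) dev i j) ^+ 2 + (2 * t)^-1))).
apply: (@le_trans _ _ (\sum_(i < k) N (v i) / (m%:R * e) * ((t / 2) * m%:R + (2 * t)^-1))).
  apply: ler_sum => i _; rewrite wordEZ; apply: ler_wpM2l.
    by apply: divr_ge0; [exact: seminorm_ge0|exact: ltW].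
  rewrite wordED wordEZ lerD//; first by rewrite ler_pM2l ?(divr_gt0 t0)//; exact: variance.
  apply: (@le_trans _ _ ((2 * t)^-1 * wordE q k m (fun=> 1))); last first.
    by rewrite wordE1 q1 expr1n mulr1.
  by rewrite -wordEZ; apply: le_wordE => // w _; rewrite mulr1.
rewrite -!mulr_suml -/L.
have -> : L / (m%:R * e) * (t / 2 * m%:R + (2 * t)^-1) =
   (L / e * t) / 2 + (2 * L / (t * e)) / m%:R / 4.
  by field; rewrite !gt_eqF.
have -> : L / e * t = L / (L + 1) / 2 by rewrite /t; field; rewrite !gt_eqF// ltr_wpDl.
have h1 : L / (L + 1) <= 1 by rewrite ler_pdivrMr ?mul1r ?lerDl ?ltr_wpDl.
have h2 : 2 * L / (t * e) / m%:R <= 1 by rewrite ler_pdivrMr ?mul1r.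
lra.
Qed.

End LargeNumbers.

(** By Bernoulli's inequality the powers of a number above 1 are unbounded. This removes the factor
    1/2 that the law of large numbers leaves in front of an [m]-th power. *)
Lemma le1_of_bounded_powers (x : R) m0 :
  0 <= x -> (forall m, (m0 <= m)%N -> x ^+ m <= 2) -> x <= 1.
Proof.
move=> x0 xm; rewrite leNgt; apply/negP => x1.
have y0 : 0 < x - 1 by rewrite subr_gt0.
have bern n : 1 + n%:R * (x - 1) <= x ^+ n.
  elim: n => [|n IH]; first by rewrite mul0r addr0 expr0.
  rewrite exprS -natr1.
  have : x * (1 + n%:R * (x - 1)) <= x * x ^+ n by rewrite ler_pM2l// (lt_trans _ x1).
  by apply: le_trans; have := mulr_ge0 (ler0n R n) (sqr_ge0 (x - 1)); nra.
pose m := maxn m0 (Num.truncn (x - 1)^-1).+1.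
have := xm m (leq_maxl _ _); apply/negP; rewrite -ltNge.
apply: (lt_le_trans _ (bern m)); suff : 1 < m%:R * (x - 1) by lra.
rewrite -ltr_pdivrMr// mul1r; apply: (lt_le_trans (truncnS_gt _)).
by rewrite ler_nat leq_maxr.
Qed.

End WordExpectation.

(** * Closedness and continuity for pointwise expressions *)

Section RealContinuity.
Context {R : realType} {T : topologicalType}.

Lemma closed_linear_eq (f g h : T -> R) (c : R) :
  continuous f -> continuous g -> continuous h ->
  closed [set t | f t - c * g t - h t = 0].
Proof.
move=> cf cg ch; pose F t := f t - c * g t - h t.
have cF : continuous F.
  move=> t; apply: cvgB; last exact: ch.
  apply: cvgB; first exact: cf.
  by apply: cvgM; [exact: cvg_cst|exact: cg].
rewrite (_ : [set _ | _] = F @^-1` [set 0])//.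
by move/continuous_closedP: cF; apply; exact: closed_eq.
Qed.

Lemma continuous_sum_expR (q : nat -> R) (F : nat -> T -> R) k :
  (forall j, continuous (F j)) ->
  continuous (fun t => \sum_(j < k) q j * expR (F j t)).
Proof.
move=> cF; elim: k => [|k IH].
  rewrite (_ : (fun _ => _) = cst 0); first by move=> t; exact: cvg_cst.
  by apply/funext => t; rewrite big_ord0.
rewrite (_ : (fun _ => _) =
    (fun t => \sum_(j < k) q j * expR (F j t) + q k * expR (F k t))); last first.
  by apply/funext => t; rewrite big_ord_recr.
move=> t; apply: cvgD; first exact: IH.
apply: cvgM; first exact: cvg_cst.
apply: (@continuous_comp _ _ _ (F k) expR); first exact: cF.
exact: continuous_expR.
Qed.

End RealContinuity.

(** * Dual balls and the minimisation of exponential moments *)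

Section DualBall.
Context {R : realType} {X : lmodType R}.
Implicit Types (N lam mu : X -> R).

Definition linear_form lam := forall (a : R) x y, lam (a *: x + y) = a * lam x + lam y.

Definition dual_ball N (B : R) : set (X -> R) :=
  [set lam | linear_form lam /\ forall x, `|lam x| <= B * N x].

Section LinearForm.
Context lam (lam_lin : linear_form lam).

Lemma linear_form0 : lam 0 = 0.
Proof. by have := lam_lin 1 0 0; rewrite scaler0 addr0; lra. Qed.

Lemma linear_formZ a x : lam (a *: x) = a * lam x.
Proof. by rewrite -[a *: x]addr0 lam_lin linear_form0 addr0. Qed.

Lemma linear_formD x y : lam (x + y) = lam x + lam y.
Proof. by have := lam_lin 1 x y; rewrite scale1r mul1r. Qed.

Lemma linear_formN x : lam (- x) = - lam x.
Proof. by rewrite -scaleN1r linear_formZ mulN1r. Qed.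

Lemma linear_formB x y : lam (x - y) = lam x - lam y.
Proof. by rewrite linear_formD linear_formN. Qed.

Lemma linear_form_sum I (s : seq I) (P : pred I) (F : I -> X) :
  lam (\sum_(i <- s | P i) F i) = \sum_(i <- s | P i) lam (F i).
Proof.
by apply: (big_morph lam _ linear_form0) => x y; exact: linear_formD.
Qed.

End LinearForm.

Local Notation ptwise := (prod_topology (fun _ : X => (R : topologicalType))).

Lemma continuous_eval x : continuous (fun f : ptwise => f x : R).
Proof. by move=> f; exact: (@proj_continuous X (fun=> (R : topologicalType)) x f). Qed.

(** Banach-Alaoglu: for pointwise convergence, linearity is a closed condition inside a Tychonoff
    product of segments. *)
Lemma compact_dual_ball N B : compact (dual_ball N B : set ptwise).
Proof.
pose box := [set f : ptwise | forall x, `[- (B * N x), B * N x]%classic (f x)].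
have cbox : compact box.
  exact: (@tychonoff X (fun=> (R : topologicalType)) (fun x => `[- (B * N x), B * N x]%classic)
    (fun x => @segment_compact _ _ _)).
have -> : dual_ball N B = box `&` [set f | linear_form f].
  apply/seteqP; split=> [f [lf Nf]|f [bf lf]]; split=> //= x.
    by rewrite set_itvE /= -ler_norml.
  by have := bf x; rewrite set_itvE /= -ler_norml.
apply: (subclosed_compact _ cbox); last by move=> f [].
apply: closedI; first by apply: compact_closed cbox; exact: hausdorff_product.
have -> : [set f : ptwise | linear_form f] = \bigcap_(t in [set: R * X * X])
    [set f : ptwise | f (t.1.1 *: t.1.2 + t.2) - t.1.1 * f t.1.2 - f t.2 = 0].
  apply/seteqP; split=> [f lf [[a x] y] _ /=|f h a x y].
    by rewrite lf; ring.
  by have := h ((a, x), y) I => /=; lra.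
apply: closed_bigI => -[[a x] y] _ /=.
exact: (@closed_linear_eq R ptwise (fun f => f (a *: x + y)) (fun f => f x)
  (fun f => f y) a (@continuous_eval _) (@continuous_eval _) (@continuous_eval _)).
Qed.

Section Exponential.
Context (q : nat -> R) (v : nat -> X) (k : nat).

Definition wexp lam : R := \sum_(j < k) q j * expR (lam (v j)).

Lemma continuous_wexp : continuous (wexp : ptwise -> R).
Proof.
exact: (@continuous_sum_expR R ptwise q (fun j f => f (v j)) k
  (fun j => @continuous_eval (v j))).
Qed.

(* First-order optimality, in the direction [mu - lam]. *)
Lemma wexp_min_le N B lam mu : seminorm N -> 0 <= B -> (forall j, 0 <= q j) ->
  dual_ball N B lam -> dual_ball N B mu ->
  (forall nu, dual_ball N B nu -> wexp lam <= wexp nu) ->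
  0 <= \sum_(j < k) q j * expR (lam (v j)) * (mu (v j) - lam (v j)).
Proof.
move=> Ns B0 q0 [llin lN] [mlin mN] lmin; rewrite leNgt; apply/negP.
set A := \sum_(j < k) _ => A0.
pose p (j : nat) := q j * expR (lam (v j)).
pose u (j : nat) := mu (v j) - lam (v j).
pose U := \sum_(j < k) `|u j|; pose D := \sum_(j < k) p j * u j ^+ 2.
have p0 j : 0 <= p j by rewrite mulr_ge0 ?expR_ge0.
have U0 : 0 <= U by exact: sumr_ge0.
have D0 : 0 <= D by apply: sumr_ge0 => j _; rewrite mulr_ge0 ?sqr_ge0.
(* The step [s = M^-1] is at most 1, so that [nu] stays in the ball; it keeps every exponent within
   1/2 and makes the quadratic error [s * (2 * D)] smaller than the linear gain [- A]. *)
pose M := 1 + 2 * U + 2 * D / (- A).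
have DA0 : 0 <= 2 * D / (- A) by rewrite divr_ge0 ?mulr_ge0// oppr_ge0 ltW.
have M1 : 1 <= M by rewrite /M; lra.
have M0 : 0 < M by lra.
pose s := M^-1.
have s0 : 0 < s by rewrite invr_gt0.
have s1 : s <= 1 by rewrite invf_le1.
have sU : s * U <= 1 / 2.
  by rewrite mulrC ler_pdivrMr// /M; lra.
have sD : s * (2 * D) < - A.
  have An : 0 < - A by rewrite oppr_gt0.
  rewrite mulrC ltr_pdivrMr// (_ : - A * M = - A + 2 * (- A * U) + 2 * D); last first.
    by rewrite /M; field; rewrite lt_eqF.
  by rewrite ltrDr ltr_wpDr// mulr_ge0// mulr_ge0// ltW.
pose nu x := lam x + s * (mu x - lam x).
have : dual_ball N B nu.
  split=> [a x y|x]; first by rewrite /nu llin mlin; ring.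
  rewrite /nu (_ : _ + _ = (1 - s) * lam x + s * mu x); last by ring.
  apply: le_trans (ler_normD _ _) _; rewrite !normrM.
  have := lN x; have := mN x; rewrite (ger0_norm (ltW s0)) ger0_norm ?subr_ge0//.
  nra.
move/lmin; rewrite /wexp -subr_ge0 -sumrB; apply/negP; rewrite -ltNge.
have term (j : 'I_k) : q j * expR (nu (v j)) - q j * expR (lam (v j)) <=
    s * (p j * u j) + 2 * s ^+ 2 * (p j * u j ^+ 2).
  rewrite /nu expRD -/(u j) mulrA -/(p j).
  set w := s * u j.
  have w2 : `|w| <= 1 / 2.
    rewrite normrM (ger0_norm (ltW s0)); apply: le_trans sU.
    rewrite ler_pM2l// /U (bigD1 j)//= lerDl; exact: sumr_ge0.
  (* From [1 - w <= expR (- w)], since [(1 - w) (1 + w + 2 w^2) - 1 = w^2 (1 - 2 w)] is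
     nonnegative. *)
  have ew : expR w <= 1 + w + 2 * w ^+ 2.
    have := expR_ge1Dx (- w); rewrite expRN => hw.
    have e0 := expR_gt0 w; move: w2; rewrite ler_norml => /andP[w2l w2r].
    have : (1 - w) * expR w <= 1 by rewrite -ler_pdivlMr ?div1r.
    have : 0 <= w ^+ 2 * (1 - 2 * w) by rewrite mulr_ge0 ?sqr_ge0//; lra.
    move=> h1 h2; have w10 : 0 < 1 - w by lra.
    rewrite -(ler_pM2l w10); apply: le_trans h2 _; rewrite -subr_ge0.
    by rewrite (_ : _ - 1 = w ^+ 2 * (1 - 2 * w)) //; ring.
  have -> : s * (p j * u j) + 2 * s ^+ 2 * (p j * u j ^+ 2) = p j * (w + 2 * w ^+ 2).
    by rewrite /w; ring.
  by rewrite -[X in _ - X]mulr1 -mulrBr ler_wpM2l//; lra.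
apply: (le_lt_trans (ler_sum _ (fun j _ => term j))).
rewrite big_split /= -!mulr_sumr -/D.
rewrite (_ : _ + _ = s * (A + s * (2 * D))); last by rewrite /A; ring.
by rewrite pmulr_rlt0//; lra.
Qed.

End Exponential.

(* Chernoff's bound is sharp: the exponential moment is minimised over the dual ball,
   and either the tilted barycenter [z] has norm at least [r], so that Jensen's
   inequality applies, or the tilted law of large numbers does. *)
Lemma exists_wexp_le N (q : nat -> R) (v : nat -> X) k (a r : R) :
  seminorm N -> (forall j, 0 <= q j) -> \sum_(j < k) q j <= 1 -> 0 <= a -> 0 < r ->
  (forall m, (0 < m)%N ->
    wordE q k m (fun w => (N (\sum_(j <- w) v j) < m%:R * r)%R%:R) <= expR (- a) ^+ m) ->
  exists2 lam, dual_ball N (a / r) lam & wexp q v k lam <= expR (- a).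
Proof.
(* With this radius, [B * N z >= a] as soon as [N z >= r]. *)
move=> Ns q0 q1 a0 r0 hw; set B := a / r.
have B0 : 0 <= B by rewrite divr_ge0// ltW.
have ball0 : dual_ball N B (fun=> 0).
  split=> [c x y|x]; first by rewrite mulr0 addr0.
  by rewrite normr0 mulr_ge0// seminorm_ge0.
have [lam /set_mem lball lmin] : exists2 lam, lam \in dual_ball N B &
    forall nu, nu \in dual_ball N B -> wexp q v k lam <= wexp q v k nu.
  apply: (@compact_EVT_min ptwise R (wexp q v k)).
  - by exists (fun=> 0).
  - exact: compact_dual_ball.
  - by apply: continuous_subspaceT; exact: continuous_wexp.
have {}lmin nu : dual_ball N B nu -> wexp q v k lam <= wexp q v k nu.
  by move=> /mem_set; exact: lmin.
exists lam => //; set Phi := wexp q v k lam.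
have Phi0 : 0 <= Phi by apply: sumr_ge0 => j _; rewrite mulr_ge0 ?expR_ge0.
have [->|Phi_neq0] := eqVneq Phi 0; first exact: expR_ge0.
have {Phi_neq0} Phi0 : 0 < Phi by rewrite lt_def Phi_neq0.
(* The exponentially tilted probability weights, with barycenter [z]. *)
pose th (j : nat) := q j * expR (lam (v j)) / Phi.
have th0 j : 0 <= th j by rewrite divr_ge0 ?mulr_ge0 ?expR_ge0// ltW.
have th1 : \sum_(j < k) th j = 1 by rewrite -mulr_suml divff// gt_eqF.
pose z := \sum_(j < k) th j *: v j.
have [llin lN] := lball.
(* Optimality is tested against [B] times the form supporting [N] at [z]: under the tilted weights
   it says that [lam z] is at most [- (B * N z)], the least value allowed by the ball. *)
have lamz : lam z = - (B * N z).
  have [mu mlin [mN muz]] := hahn_banach_supporting z Ns.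
  have Bmu : dual_ball N B (fun x => B * mu x).
    split=> [c x y|x]; first by rewrite mlin; ring.
    by rewrite normrM (ger0_norm B0) ler_wpM2l.
  have := wexp_min_le Ns B0 q0 lball Bmu lmin.
  have -> : \sum_(j < k) q j * expR (lam (v j)) * (B * mu (v j) - lam (v j)) =
      Phi * (B * mu z - lam z).
    rewrite /z (linear_form_sum mlin) (linear_form_sum llin) mulr_sumr -sumrB mulr_sumr.
    apply: eq_bigr => j _; rewrite (linear_formZ mlin) (linear_formZ llin) /th.
    by field; rewrite gt_eqF.
  rewrite pmulr_rge0// subr_ge0 muz mulrN => h.
  apply/eqP; rewrite eq_le h /=.
  by have := lN z; rewrite ler_norml => /andP[].
have qE j : q j = Phi * th j * expR (- lam (v j)).
  by rewrite expRN /th; field; rewrite gt_eqF ?expR_gt0// gt_eqF.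
(* Far barycenter: undoing the tilt, the total mass of [q] is [Phi] times the tilted mean of
   [expR (- lam)], hence at least [Phi * expR (- lam z)] by Jensen; as the mass is at most 1,
   [Phi <= expR (lam z) <= expR (- a)]. *)
have [Nz|Nz] := leP r (N z).
  have lamza : lam z <= - a.
    rewrite lamz lerN2 (_ : a = B * r) ?ler_wpM2l//.
    by rewrite /B divfK// gt_eqF.
  suff h : Phi * expR (- lam z) <= 1.
    apply: le_trans (_ : expR (lam z) <= _); last by rewrite ler_expR.
    by rewrite -[expR (lam z)]invrK -expRN -div1r ler_pdivlMr ?expR_gt0.
  apply: le_trans q1; rewrite (eq_bigr _ (fun (j : 'I_k) _ => qE j)).
  under eq_bigr => j _ do rewrite -mulrA.
  rewrite -mulr_sumr ler_pM2l//.
  (* Jensen's inequality through the tangent of the exponential at [- lam z]. *)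
  have tangent (j : 'I_k) : th j * (expR (- lam z) * (1 + (lam z - lam (v j)))) <=
      th j * expR (- lam (v j)).
    apply: ler_wpM2l => //.
    have -> : expR (- lam (v j)) = expR (- lam z) * expR (lam z - lam (v j)).
      by rewrite -expRD; congr expR; ring.
    by rewrite ler_pM2l ?expR_gt0// expR_ge1Dx.
  apply: le_trans (ler_sum _ (fun j _ => tangent j)).
  under eq_bigr => j _ do rewrite mulrCA.
  rewrite -mulr_sumr ler_peMr ?expR_ge0//.
  under eq_bigr => j _ do rewrite mulrDr mulr1 mulrBr.
  rewrite big_split sumrB /= th1.
  have -> : \sum_(j < k) th j * lam z = lam z by rewrite -mulr_suml th1 mul1r.
  have -> : \sum_(j < k) th j * lam (v j) = lam z.
    by rewrite (linear_form_sum llin); apply: eq_bigr => j _; rewrite linear_formZ.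
  by rewrite subrr addr0.
have lamz0 : lam z <= 0 by rewrite lamz oppr_le0 mulr_ge0// seminorm_ge0.
rewrite -(lnK (Phi0 : Phi \is Num.pos)) ler_expR; apply/ler_addgt0Pr => eta eta0.
(* Words with mean within [e] of [z] have their mean in the ball of radius [r], and [lam] varies by
   at most [eta] on them. *)
pose e := Num.min (r - N z) (eta / (B + 1)).
have e0 : 0 < e by rewrite lt_min subr_gt0 Nz divr_gt0// ltr_wpDl.
have er : e <= r - N z by rewrite ge_min lexx.
have eB : B * e <= eta.
  have : e <= eta / (B + 1) by rewrite ge_min lexx orbT.
  rewrite ler_pdivlMr ?ltr_wpDl// mulrDr mulr1 [e * B]mulrC; apply: le_trans.
  by rewrite lerDl ltW.
have [m0 hm0] := weak_law_large_numbers v Ns th0 th1 e0.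
(* Since [lam z <= 0], the bound [y <= 1] gives [ln Phi <= - a + eta]; it will follow from
   [y ^+ m <= 2] for all large [m]. *)
pose y := Phi * expR (- lam z - eta + a).
suff : y <= 1.
  have -> : y = expR (ln Phi + (- lam z - eta + a)) by rewrite expRD lnK.
  by rewrite -expR0 ler_expR; lra.
have y0 : 0 <= y by rewrite mulr_ge0 ?expR_ge0// ltW.
apply: (@le1_of_bounded_powers _ _ m0.+1) => // m mm0.
have m0' : (0 < m)%N by exact: leq_ltn_trans mm0.
have := hw m m0'; set W := wordE q k m _ => hW.
suff : 1 / 2 * (Phi * expR (- lam z - eta)) ^+ m <= W.
  move=> /le_trans/(_ hW) h.
  have ea : expR a ^+ m * expR (- a) ^+ m = 1.
    by rewrite -exprMn -expRD subrr expR0 expr1n.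
  have := ler_wpM2l (exprn_ge0 m (expR_ge0 a)) h.
  by rewrite ea /y (expRD (- lam z - eta)) mulrA [(_ * expR a) ^+ m]exprMn; lra.
pose good (w : seq nat) : R := (N (\sum_(j <- w) v j - m%:R *: z) < m%:R * e)%R%:R.
have hgood : 1 / 2 <= wordE th k m good by apply: hm0; exact: ltnW.
apply: (@le_trans _ _ ((Phi * expR (- lam z - eta)) ^+ m * wordE th k m good)).
  by rewrite mulrC ler_wpM2l// exprn_ge0// mulr_ge0 ?expR_ge0// ltW.
(* The original weights are the tilted ones with density [Phi ^+ m * expR (- lam S)] on words with
   sum [S], which is bounded below on good words. *)
have -> : W = wordE (fun j => th j * (Phi * expR (- lam (v j)))) k m
    (fun w => (N (\sum_(j <- w) v j) < m%:R * r)%R%:R).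
  by rewrite /W; congr (wordE _ _ _ _); apply/funext => j; rewrite {1}qE; ring.
rewrite wordE_reweight -wordEZ; apply: le_wordE => // w /andP[/eqP sw aw].
have -> : \prod_(j <- w) (Phi * expR (- lam (v j))) = Phi ^+ m * expR (- lam (\sum_(j <- w) v j)).
  rewrite (linear_form_sum llin) -sw; elim: (w) => [|j u IH].
    by rewrite !big_nil oppr0 expR0 mulr1 expr0.
  by rewrite !big_cons IH opprD expRD exprS; ring.
rewrite /good; have [hN|_] := ltP; last first.
  by rewrite mulr0 mulr_ge0// mulr_ge0 ?expR_ge0// exprn_ge0// ltW.
set S := \sum_(j <- w) v j in hN *.
have mpos : 0 < m%:R :> R by rewrite ltr0n.
have -> : N S < m%:R * r.
  have -> : S = (S - m%:R *: z) + m%:R *: z by rewrite subrK.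
  apply: le_lt_trans (Ns.1 _ _) _; rewrite Ns.2 normr_nat; nra.
rewrite !mulr1 exprMn ler_pM2l ?exprn_gt0// -expRM_natl ler_expR.
have : lam (S - m%:R *: z) <= B * (m%:R * e).
  apply: le_trans (ler_norm _) _; apply: le_trans (lN _) _.
  by rewrite ler_wpM2l// ltW.
rewrite (linear_formB llin) (linear_formZ llin); nra.
Qed.

End DualBall.

(** * Countable alphabets and concatenation of words *)

Section WordLimits.
Context {R : realType} {X : lmodType R}.
Implicit Types (N lam : X -> R) (v : nat -> X) (q : nat -> R).

Lemma exists_wexp_le_all N q v (a r : R) :
  seminorm N -> (forall j, 0 <= q j) -> (forall k, \sum_(j < k) q j <= 1) ->
  0 <= a -> 0 < r ->
  (forall k m, (0 < m)%N ->
    wordE q k m (fun w => (N (\sum_(j <- w) v j) < m%:R * r)%R%:R) <= expR (- a) ^+ m) ->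
  exists2 lam, dual_ball N (a / r) lam & forall k, wexp q v k lam <= expR (- a).
Proof.
move=> Ns q0 q1 a0 r0 hw.
pose T := prod_topology (fun _ : X => (R : topologicalType)).
have ex k : exists lam, dual_ball N (a / r) lam /\ wexp q v k lam <= expR (- a).
  by have [lam] := exists_wexp_le Ns q0 (q1 k) a0 r0 (hw k); exists lam.
have [l hl] := choice ex.
have [lam [lamK lamc]] : dual_ball N (a / r) `&` cluster ((l : nat -> T) @ \oo) !=set0.
  apply: (@compact_dual_ball R X N (a / r) ((l : nat -> T) @ \oo) _).
  by exists 0%N => // n _; case: (hl n).
exists lam => // k.
pose C : set T := [set f | wexp q v k f <= expR (- a)].
have clC : closed C.
  have /continuous_closedP := @continuous_wexp R X q v k.
  by move=> /(_ _ (@closed_le R (expR (- a)))).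
(* The terms are nonnegative, so for [n >= k] the form found for [n] letters also obeys the bound
   for [k] letters; this closed condition passes to the cluster point. *)
apply: (clC lam) => B nB; apply: lamc => //; exists k => // n /= kn.
apply: le_trans (hl n).2; rewrite /wexp -!(big_mkord xpredT (fun j => q j * expR (l n (v j)))).
rewrite [leRHS](big_cat_nat (leq0n k) kn)//= lerDl; apply: sumr_ge0 => j _.
by rewrite mulr_ge0 ?expR_ge0.
Qed.

Lemma wordE_ge_letter q k j n (f : seq nat -> R) : (forall j, 0 <= q j) ->
  (forall w, 0 <= f w) -> (j < k)%N -> q j ^+ n * f (nseq n j) <= wordE q k n f.
Proof.
move=> q0 f0 jk; elim: n f f0 => [|n IH] f f0 /=; first by rewrite expr0 mul1r.
rewrite (bigD1 (Ordinal jk)) //= exprS -mulrA.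
apply: le_trans (_ : q j * wordE q k n (fun w => f (j :: w)) <= _).
  by rewrite ler_wpM2l// IH.
by rewrite lerDl; apply: sumr_ge0 => i _; rewrite mulr_ge0// wordE_ge0.
Qed.

Lemma wordE_gt0_letter q k m (f : seq nat -> R) : (forall j, 0 <= q j) ->
  (0 < m)%N -> 0 < wordE q k m f -> exists2 j, (j < k)%N & 0 < q j.
Proof.
case: m => // m q0 _ /= w0; apply: contrapT => h.
move: w0; rewrite big1 ?ltxx// => j _.
have [->|qj] := eqVneq (q j) 0; first by rewrite mul0r.
by case: h; exists j => //; rewrite lt_def qj q0.
Qed.

(** A word of length [n] is built from [n %/ m] blocks of length [m] followed by [n %% m] copies of
    the letter [j]. The length of this tail is below [m], so for large [n] its norm fits in the
    slack [n (t' - t)]. *)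
Lemma wordE_superadditive N q v k m j (t t' : R) :
  seminorm N -> (forall j, 0 <= q j) -> (j < k)%N -> (0 < m)%N -> 0 < t -> t < t' ->
  let c n s := wordE q k n (fun w => (N (\sum_(j <- w) v j) < n%:R * s)%R%:R) in
  exists n0, forall n, (n0 <= n)%N ->
    c m t ^+ (n %/ m) * q j ^+ (n %% m) <= c n t'.
Proof.
move=> Ns q0 jk m0 t0 tt' c.
(* The inequality is weak so that the empty word, which starts the induction on blocks, satisfies
   it. *)
pose b (n : nat) w : R := (N (\sum_(j <- w) v j) <= n%:R * t)%R%:R.
have N0 : N 0 = 0 := sublinear0 (seminorm_sublinear Ns).
have blocks l : c m t ^+ l <= wordE q k (l * m) (b (l * m)%N).
  elim: l => [|l IH]; first by rewrite mul0n /= /b big_nil N0 mul0r lexx expr0.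
  rewrite mulSn wordE_cat exprS /c mulrC -wordEZ; apply: le_wordE => // u _.
  apply: le_trans (_ : wordE q k (l * m) (fun w =>
      (N (\sum_(j <- u) v j) < m%:R * t)%R%:R * b (l * m)%N w) <= _).
    by rewrite wordEZ mulrC ler_wpM2l.
  apply: le_wordE => // w _; rewrite /b.
  have [h1|_] := ltP (N (\sum_(j <- u) v j)); last by rewrite mul0r.
  have [h2|_] := leP (N (\sum_(j <- w) v j)); last by rewrite mulr0.
  have h : N (\sum_(j <- u ++ w) v j) <= (m + l * m)%:R * t.
    by rewrite big_cat natrD mulrDl; apply: le_trans (Ns.1 _ _) _; rewrite lerD// ltW.
  by rewrite h mulr1.
exists (Num.truncn (m%:R * N (v j) / (t' - t))).+1 => n nn0.
have d0 : 0 < t' - t by rewrite subr_gt0.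
have big_n : m%:R * N (v j) < n%:R * (t' - t).
  rewrite -ltr_pdivrMr//; apply: (lt_le_trans (truncnS_gt _)).
  by rewrite ler_nat.
rewrite {2}/c /= {3}(divn_eq n m) wordE_cat.
apply: le_trans (_ : wordE q k (n %/ m * m) (fun u => q j ^+ (n %% m) * b (n %/ m * m)%N u) <= _).
  by rewrite wordEZ mulrC ler_wpM2l// exprn_ge0.
apply: le_wordE => // u _.
apply: le_trans (wordE_ge_letter _ q0 _ jk) => //; rewrite ler_wpM2l ?exprn_ge0//.
rewrite /b; have [h|_] := leP (N (\sum_(i <- u) v i)); last exact: ler0n.
have Nseq i : N (\sum_(j0 <- nseq i j) v j0) <= i%:R * N (v j).
  elim: i => [|i IH]; first by rewrite big_nil N0 mul0r.
  by rewrite /= big_cons -nat1r mulrDl mul1r; apply: le_trans (Ns.1 _ _) _; rewrite lerD2l.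
have h2 : (n %% m)%:R * N (v j) <= m%:R * N (v j).
  apply: ler_wpM2r; first exact: seminorm_ge0.
  by rewrite ler_nat ltnW// ltn_mod.
have h3 : (n %/ m * m)%:R * t <= n%:R * t.
  apply: ler_wpM2r; first exact: ltW.
  by rewrite ler_nat leq_trunc_div.
have hlt : N (\sum_(j0 <- u ++ nseq (n %% m) j) v j0) < n%:R * t'.
  rewrite big_cat; apply: le_lt_trans (Ns.1 _ _) _.
  by have := Nseq (n %% m)%N; nra.
by rewrite hlt.
Qed.

End WordLimits.

(* The name [minkowski] alone denotes the integral inequality of MathComp-Analysis. *)
Local Notation gauge := Defs.minkowski.

(** * The Minkowski functional of a symmetric open convex set *)

Section Minkowski.
Context {R : realType} {X : lmodType R} (C : set X).
Hypotheses (Csym : symmetric_set C) (Copen : algebraically_open C)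
  (Cconv : is_convex_set C) (C0 : C 0).

Let G x := [set t : R | 0 < t /\ scale_set t C x].

Let GE x t : G x t <-> 0 < t /\ C (t^-1 *: x).
Proof.
split=> [[t0 [c Cc <-]]|[t0 Cx]]; split=> //.
  by rewrite scalerA mulVf ?gt_eqF// scale1r.
by exists (t^-1 *: x) => //; rewrite scalerA divff ?gt_eqF// scale1r.
Qed.

Let Cshrink x (u : R) : 0 <= u <= 1 -> C x -> C (u *: x).
Proof.
move=> u01 Cx; have := Cconv C0 Cx u01.
by rewrite scaler0 add0r.
Qed.

Let Gup x s t : G x s -> s <= t -> G x t.
Proof.
move=> /GE[s0 Cx] st; apply/GE; have t0 := lt_le_trans s0 st; split=> //.
have -> : t^-1 *: x = (s / t) *: (s^-1 *: x).
  by rewrite scalerA mulrAC divff ?gt_eqF// mul1r.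
by apply: Cshrink => //; rewrite (divr_ge0 (ltW s0) (ltW t0)) ler_pdivrMr// mul1r.
Qed.

Let G_has_inf x : has_inf (G x).
Proof.
split; last by exists 0 => t [/ltW].
have [e e0 he] := Copen x C0.
exists (2 / e); apply/GE; split; first exact: divr_gt0.
rewrite invf_div; have := he (e / 2); rewrite add0r; apply.
by rewrite gtr0_norm ?divr_gt0// ltr_pdivrMr// mulr2n mulrDr mulr1 ltrDl.
Qed.

Let M_lt x t : gauge C x < t -> G x t.
Proof.
move=> Mt; have d0 : 0 < t - gauge C x by rewrite subr_gt0.
have [s Gs] := inf_adherent d0 (G_has_inf x).
by rewrite addrC subrK => st; exact: Gup Gs (ltW st).
Qed.

Let M_le x t : G x t -> gauge C x <= t.
Proof. by move=> Gt; apply: ge_inf => //; case: (G_has_inf x). Qed.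

Let M_ge0 x : 0 <= gauge C x.
Proof. by apply: lb_le_inf => [|t [/ltW]//]; case: (G_has_inf x). Qed.

Lemma minkowski_lt1 x : C x <-> gauge C x < 1.
Proof.
split=> [Cx|/M_lt/GE[_]]; last by rewrite invr1 scale1r.
(* Openness along the ray through [x] leaves room to dilate [x] by [1 + e / 2], which makes the
   inequality strict. *)
have [e e0 he] := Copen x Cx.
have e2 : 0 < 1 + e / 2 by rewrite addr_gt0// divr_gt0.
apply: (@le_lt_trans _ _ (1 + e / 2)^-1); last first.
  by rewrite invf_lt1// ltrDl divr_gt0.
apply/M_le/GE; split; first by rewrite invr_gt0.
rewrite invrK scalerDl scale1r; apply: he.
by rewrite gtr0_norm ?divr_gt0// ltr_pdivrMr// mulr2n mulrDr mulr1 ltrDl.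
Qed.

Lemma seminorm_minkowski : seminorm (gauge C).
Proof.
have MZ_le a x : 0 < a -> gauge C (a *: x) <= a * gauge C x.
  move=> a0; rewrite -ler_pdivrMl//; apply: lb_le_inf; first by case: (G_has_inf x).
  move=> t /GE[t0 Cx]; rewrite ler_pdivrMl//; apply/M_le/GE.
  split; first exact: mulr_gt0.
  by rewrite scalerA invfM mulrAC mulVf ?mul1r// gt_eqF.
have MZ_pos a x : 0 < a -> gauge C (a *: x) = a * gauge C x.
  move=> a0; apply/eqP; rewrite eq_le MZ_le//=.
  have ai : 0 < a^-1 by rewrite invr_gt0.
  have := MZ_le _ (a *: x) ai; rewrite scalerA mulVf ?gt_eqF// scale1r.
  by rewrite ler_pdivlMl.
have MN x : gauge C (- x) = gauge C x.
  congr inf; apply/seteqP; split=> t /GE[t0 Cx]; apply/GE; split=> //.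
    by rewrite -[x]opprK scalerN; exact: Csym.
  by rewrite scalerN; exact: Csym.
split=> [x y|a x].
  apply/ler_addgt0Pr => e e0; have e2 : 0 < e / 2 by rewrite divr_gt0.
  have /M_lt/GE[s0 Cx] : gauge C x < gauge C x + e / 2 by rewrite ltrDl.
  have /M_lt/GE[t0 Cy] : gauge C y < gauge C y + e / 2 by rewrite ltrDl.
  set s := gauge C x + e / 2 in s0 Cx; set t := gauge C y + e / 2 in t0 Cy.
  have -> : gauge C x + gauge C y + e = s + t by rewrite /s /t; lra.
  have st0 : 0 < s + t by rewrite addr_gt0.
  apply/M_le/GE; split=> //.
  have u01 : 0 <= t / (s + t) <= 1.
    by rewrite (divr_ge0 (ltW t0) (ltW st0)) ler_pdivrMr// mul1r lerDr ltW.
  have := Cconv Cx Cy u01; rewrite !scalerA scalerDr.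
  congr (C (_ *: _ + _ *: _)); by field; rewrite ?gt_eqF.
have [a0|a0|->] := ltgtP a 0.
- rewrite ltr0_norm// -MZ_pos ?oppr_gt0// scaleNr MN//.
- by rewrite gtr0_norm// MZ_pos.
rewrite scale0r normr0 mul0r; apply/eqP; rewrite eq_le M_ge0 andbT.
apply/ler_addgt0Pr => e e0; rewrite add0r.
by apply/M_le/GE; split=> //; rewrite scaler0.
Qed.

End Minkowski.

(** * Basic neighbourhoods as balls of separable seminorms *)

Section AdmissibleSeminorms.
Context {R : realType} {X : lmodType R}.
Implicit Types (N : X -> R).

Definition separable_seminorm N :=
  exists e : nat -> X, forall x (t : R), 0 < t -> exists j, N (x - e j) < t.

Lemma seminorm_max N1 N2 : seminorm N1 -> seminorm N2 ->
  seminorm (fun x => Num.max (N1 x) (N2 x)).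
Proof.
move=> [D1 Z1] [D2 Z2]; split=> [x y|a x].
  by rewrite ge_max (le_trans (D1 _ _)) ?(le_trans (D2 _ _))//;
    rewrite lerD// le_max lexx ?orbT.
by rewrite Z1 Z2 maxr_pMr.
Qed.

Lemma seminorm_scale N (l : R) : 0 < l -> seminorm N -> seminorm (fun x => N x / l).
Proof.
move=> l0 [D Z]; split=> [x y|a x]; last by rewrite Z mulrA.
by rewrite -mulrDl ler_pM2r ?invr_gt0.
Qed.

Lemma separable_seminorm_max N1 N2 : seminorm N1 -> seminorm N2 ->
  separable_seminorm N1 -> separable_seminorm N2 ->
  separable_seminorm (fun x => Num.max (N1 x) (N2 x)).
Proof.
move=> s1 s2 [e1 h1] [e2 h2].
(* A pair of points dense for [N1] and [N2] may have no common value, so for each pair and each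
   precision one point close to both is chosen when there is one, and 0 otherwise. *)
pose near (c : nat * nat * nat) x :=
  N1 (x - e1 c.1.1) < c.2.+1%:R^-1 /\ N2 (x - e2 c.1.2) < c.2.+1%:R^-1.
exists (fun n => if unpickle n is Some c then xget 0 (near c) else 0) => x t t0.
pose n := Num.truncn (t / 2)^-1.
have t2 : 0 < t / 2 by rewrite divr_gt0.
have n0 : 0 < n.+1%:R^-1 :> R by rewrite invr_gt0.
have nt : n.+1%:R^-1 < t / 2.
  by rewrite invf_plt ?posrE//; exact: truncnS_gt.
have [j1 hj1] := h1 x _ n0; have [j2 hj2] := h2 x _ n0.
exists (pickle (j1, j2, n)); rewrite pickleK.
have /(xgetPex 0)[] : exists y, near (j1, j2, n) y by exists x.
set y := xget _ _ => /= n1 n2.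
have tri N p : seminorm N -> N (x - p) < n.+1%:R^-1 -> N (y - p) < n.+1%:R^-1 ->
    N (x - y) < t.
  move=> sN hx hy; have -> : x - y = (x - p) + - (y - p) by rewrite opprB addrA subrK.
  by apply: le_lt_trans (sN.1 _ _) _; rewrite (seminormN _ sN) [ltRHS]splitr ltrD// (lt_trans _ nt).
by rewrite gt_max (tri _ _ s1 hj1 n1) (tri _ _ s2 hj2 n2).
Qed.

Lemma separable_seminorm_scale N (l : R) : 0 < l -> separable_seminorm N ->
  separable_seminorm (fun x => N x / l).
Proof.
move=> l0 [e h]; exists e => x t t0.
by have [j hj] := h x _ (mulr_gt0 t0 l0); exists j; rewrite ltr_pdivrMr.
Qed.

Lemma separable_seminorm_minkowski (C : set X) :
  tau_separable C -> separable_seminorm (gauge C).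
Proof.
move=> [D [/countable_injP[f finj] hD]].
exists (fun n => xget 0 [set x | D x /\ f x = n]) => x t t0.
have [d Dd hd] := hD x t t0; exists (f d).
have /(xgetPex 0)[Dy fy] : exists y, [set x | D x /\ f x = f d] y by exists d.
by rewrite (finj _ _ (mem_set Dy) (mem_set Dd) fy).
Qed.

Context (Cs : set (set X)).

Definition ball_basis N := forall x (t : R), 0 < t ->
  nbhd_basis Cs x [set y | N (y - x) < t].

(** Requiring balls of every radius to be basic neighbourhoods makes them both open and
    measurable. *)
Definition admissible N := [/\ seminorm N, separable_seminorm N & ball_basis N].

Hypothesis hCs : forall C, Cs C ->
  [/\ symmetric_set C, algebraically_open C, is_convex_set C, C 0 & tau_separable C].

(** The seminorm is the maximum of the gauges of the [C i] divided by [l i], built by induction on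
    their number from the zero seminorm. *)
Lemma nbhd_basis_ball x V : nbhd_basis Cs x V ->
  exists2 N, admissible N & V = [set y | N (y - x) < 1].
Proof.
move=> [r [C [l [hr ->]]]].
have MC i : (i < r)%N -> [/\ seminorm (gauge (C i)),
    separable_seminorm (gauge (C i)) & 0 < l i].
  move=> /hr[/hCs[c1 c2 c3 c4 c5] li]; split=> //; first exact: seminorm_minkowski.
  exact: separable_seminorm_minkowski.
have [N [sN eN hN]] : exists N, [/\ seminorm N, separable_seminorm N &
    forall y t, 0 < t -> N y < t <-> forall i, (i < r)%N -> gauge (C i) y < t * l i].
  suff: forall n, (n <= r)%N -> exists N, [/\ seminorm N, separable_seminorm N &
    forall y t, 0 < t -> N y < t <-> forall i, (i < n)%N -> gauge (C i) y < t * l i].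
    by apply.
  elim=> [_|n IH nr].
    exists (fun=> 0); split; [|by exists (fun=> 0) => y t t0; exists 0%N|by []].
    by split=> [x0 y|a y]; rewrite ?addr0 ?mulr0.
  have [N [sN eN hN]] := IH (ltnW nr); have [sC eC l0] := MC _ nr.
  exists (fun y => Num.max (N y) (gauge (C n) y / l n)); split.
  - by apply: seminorm_max => //; exact: seminorm_scale.
  - apply: separable_seminorm_max => //; first exact: seminorm_scale.
    exact: separable_seminorm_scale.
  move=> y t t0; rewrite gt_max ltr_pdivrMr//; split.
    move=> /andP[/(hN _ _ t0) h1 h2] i; rewrite ltnS leq_eqVlt => /predU1P[->//|].
    exact: h1.
  move=> h; apply/andP; split; last exact: h.
  by apply/hN => // i ilt; apply: h; rewrite ltnS ltnW.
have scaleE i t y : (i < r)%N -> 0 < t ->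
    scale_set (t * l i) (C i) y <-> gauge (C i) y < t * l i.
  move=> ir t0; have [/hCs[c1 c2 c3 c4 _] li] := hr i ir.
  have tl : 0 < t * l i by rewrite mulr_gt0.
  have [_ Z] := seminorm_minkowski c1 c2 c3 c4.
  have eqv : C i ((t * l i)^-1 *: y) <-> gauge (C i) y < t * l i.
    rewrite (minkowski_lt1 c2 c3 c4) Z gtr0_norm ?invr_gt0//.
    by rewrite mulrC ltr_pdivrMr// mul1r.
  rewrite -eqv; split=> [[c Cc <-]|Cy].
    by rewrite scalerA mulVf ?gt_eqF// scale1r.
  by exists ((t * l i)^-1 *: y) => //; rewrite scalerA divff ?gt_eqF// scale1r.
have ballE z t : 0 < t -> [set y | N (y - z) < t] =
    translate_set z (\bigcap_(i in `I_r) scale_set (t * l i) (C i)).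
  move=> t0; apply/seteqP; split=> y /=.
    move/(hN _ _ t0) => h; exists (y - z); last by rewrite addrC subrK.
    by move=> i ir; apply/scaleE => //; exact: h.
  move=> [u hu <-]; rewrite addrC addKr; apply/hN => // i ir.
  by apply/scaleE => //; exact: hu.
exists N; last first.
  rewrite (ballE x 1 ltr01); congr translate_set.
  by apply: eq_bigcapr => i _; rewrite mul1r.
split=> // z t t0; rewrite ballE//; exists r, C, (fun i => t * l i); split=> // i ir.
by have [? ?] := hr i ir; split=> //; exact: mulr_gt0.
Qed.

Lemma tauC_open_ball N x (t : R) : admissible N -> tauC_open Cs [set y | N (y - x) < t].
Proof.
move=> [sN _ bN] y /= yx; exists [set w | N (w - y) < t - N (y - x)].
  by apply: bN; rewrite subr_gt0.
move=> w /= hw; have -> : w - x = (w - y) + (y - x) by rewrite addrA subrK.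
by apply: le_lt_trans (sN.1 _ _) _; rewrite -ltrBrDr.
Qed.

Lemma F_C_ball N x (t : R) : admissible N -> 0 < t -> F_C Cs [set y | N (y - x) < t].
Proof.
by move=> [_ _ bN] t0; apply: sub_sigma_algebra; exists x; exact: bN.
Qed.

Lemma dual_space_dual_ball N B lam : admissible N -> dual_ball N B lam -> dual_space Cs lam.
Proof.
move=> [sN _ bN] [llin lN]; split=> // U oU x /= Ux.
have /nbhs_ballP[e /= e0 eU] : nbhs (lam x) U by exact: open_nbhs_nbhs.
have B1 : 0 < `|B| + 1 by rewrite ltr_wpDl.
exists [set y | N (y - x) < e / (`|B| + 1)]; first by apply: bN; rewrite divr_gt0.
move=> y /=; rewrite ltr_pdivlMr// => hy; apply: eU.
rewrite /ball /= -(linear_formB llin) -normrN -(linear_formN llin) opprB.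
apply: le_lt_trans (lN _) _; apply: le_lt_trans hy; rewrite mulrC.
by apply: ler_wpM2l; [exact: seminorm_ge0|rewrite (le_trans (ler_norm _))// lerDl].
Qed.

(** Continuity at 0 provides a unit ball on which [|lam| < 1], and homogeneity turns this into
    [|lam| <= N]. *)
Lemma dual_spaceP lam : dual_space Cs lam ->
  exists2 N, admissible N & dual_ball N 1 lam.
Proof.
move=> [llin lc]; have l0 := linear_form0 llin.
have := lc (ball (0 : R) (1 : R)) (ball_open (0 : R) (1 : R)) 0; rewrite /= l0.
move=> /(_ (ballxx _ ltr01))[V /nbhd_basis_ball[N gN ->] hV].
exists N => //; split=> // x; rewrite mul1r; apply/ler_addgt0Pr => e e0.
have [sN _ _] := gN.
(* Normalising by [N x + e] instead of [N x] covers the points where the seminorm vanishes. *)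
have s0 : 0 < N x + e by rewrite ltr_wpDl// seminorm_ge0.
have : `|lam ((N x + e)^-1 *: x)| < 1.
  have := hV ((N x + e)^-1 *: x); rewrite /= subr0 sN.2 gtr0_norm ?invr_gt0//.
  by rewrite mulrC ltr_pdivrMr// mul1r ltrDl /ball /= sub0r normrN; exact.
rewrite (linear_formZ llin) normrM gtr0_norm ?invr_gt0//.
by rewrite mulrC ltr_pdivrMr// mul1r => /ltW.
Qed.

End AdmissibleSeminorms.

(** * Closure properties of the sigma-algebra *)

Section SigmaAlgebra.
Context {R : realType} {X : lmodType R} (Cs : set (set X)).

Lemma sigma_algebra_F_C : sigma_algebra setT (F_C Cs).
Proof. exact: smallest_sigma_algebra. Qed.

Lemma F_CC A : F_C Cs A -> F_C Cs (~` A).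
Proof. by rewrite -setTD; case: sigma_algebra_F_C => _ + _; apply. Qed.

Lemma F_C_bigcup (A : nat -> set X) : (forall n, F_C Cs (A n)) -> F_C Cs (\bigcup_n A n).
Proof. by case: sigma_algebra_F_C => _ _; exact. Qed.

Lemma F_CU A B : F_C Cs A -> F_C Cs B -> F_C Cs (A `|` B).
Proof.
move=> FA FB; rewrite -bigcup2E; apply: F_C_bigcup => -[|[|n]] //=.
by case: sigma_algebra_F_C.
Qed.

Lemma F_CD A B : F_C Cs A -> F_C Cs B -> F_C Cs (A `\` B).
Proof.
move=> FA FB; rewrite (_ : A `\` B = ~` (~` A `|` B)); last by rewrite setCU setCK setDE.
by apply: F_CC; apply: F_CU => //; exact: F_CC.
Qed.

Lemma F_C_seqDU (A : nat -> set X) j : (forall n, F_C Cs (A n)) -> F_C Cs (seqDU A j).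
Proof.
move=> FA; apply: F_CD => //; elim: j => [|j IH].
  by rewrite big_ord0; case: sigma_algebra_F_C.
by rewrite big_ord_recr; exact: F_CU.
Qed.

(* Sets open for a separable seminorm are countable unions of balls of radius [1 / n]. *)
Lemma F_C_open N (G : set X) : admissible Cs N ->
  (forall x, G x -> exists2 t, 0 < t & [set y | N (y - x) < t] `<=` G) -> F_C Cs G.
Proof.
move=> gN Gopen; have [sN [e he] _] := gN.
pose B (j n : nat) := [set y : X | N (y - e j) < n.+1%:R^-1].
have -> : G = \bigcup_j \bigcup_n (if `[< B j n `<=` G >] then B j n else set0).
  apply/seteqP; split=> [x Gx|x [j _ [n _]]]; last by case: asboolP => // h; exact: h.
  have [t t0 tG] := Gopen x Gx; pose n := Num.truncn (t / 2)^-1.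
  have n0 : 0 < n.+1%:R^-1 :> R by rewrite invr_gt0.
  have nt : n.+1%:R^-1 < t / 2.
    by rewrite invf_plt ?posrE ?divr_gt0//; exact: truncnS_gt.
  have [j hj] := he x _ n0; exists j => //; exists n => //.
  case: asboolP => [//|[]] y /= yj; apply: tG => /=.
  have -> : y - x = (y - e j) + - (x - e j) by rewrite opprB addrA subrK.
  apply: le_lt_trans (sN.1 _ _) _; rewrite (seminormN _ sN) [ltRHS]splitr.
  by rewrite ltrD// (lt_trans _ nt).
apply: F_C_bigcup => j; apply: F_C_bigcup => n; case: asboolP => _.
  by apply: F_C_ball => //; rewrite invr_gt0.
by case: sigma_algebra_F_C.
Qed.

End SigmaAlgebra.

(** * Measurability of sums, means and dual forms *)

Section Measurability.
Context {R : realType} {X : lmodType R} (Cs : set (set X)).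
Hypothesis hCs : forall C, Cs C ->
  [/\ symmetric_set C, algebraically_open C, is_convex_set C, C 0 & tau_separable C].
Context {d : measure_display} {Omega : measurableType d}.
Implicit Types (Z : Omega -> X).

Lemma rv_measurable_balls Z :
  (forall N x t, admissible Cs N -> 0 < t -> measurable [set w | N (Z w - x) < t]) ->
  rv_measurable (F_C Cs) Z.
Proof.
move=> hZ A; apply: (@smallest_sub _ _ _ [set A | measurable (Z @^-1` A)]).
  split; first by rewrite /= preimage_set0.
    by move=> B /= mB; rewrite setTD preimage_setC; exact: measurableC.
  by move=> B mB /=; rewrite preimage_bigcup; apply: bigcup_measurable => k _; exact: mB.
by move=> V [x /(nbhd_basis_ball hCs)[N gN ->]]; exact: (hZ N x 1 gN).
Qed.

Lemma rv_measurable_cst x : rv_measurable (F_C Cs) (cst x : Omega -> X).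
Proof.
move=> A _; have [Ax|Ax] := pselect (A x).
  by rewrite (_ : _ @^-1` _ = setT)//; apply/seteqP; split.
by rewrite (_ : _ @^-1` _ = set0)//; apply/seteqP; split.
Qed.

(** Separability is what makes addition measurable: the event is a countable union, over dense
    points [e j] and precisions, of conditions on [Z1] and [Z2] separately. *)
Lemma rv_measurableD Z1 Z2 : rv_measurable (F_C Cs) Z1 -> rv_measurable (F_C Cs) Z2 ->
  rv_measurable (F_C Cs) (fun w => Z1 w + Z2 w).
Proof.
move=> m1 m2; apply: rv_measurable_balls => N x t gN t0.
have [sN [e he] _] := gN.
pose E (j n : nat) := [set w | N (Z1 w - e j) < n.+1%:R^-1] `&`
  [set w | N (Z2 w - (x - e j)) < t - n.+1%:R^-1].
have mE j n : measurable (E j n).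
  apply: measurableI.
    by apply: (m1 [set y | N (y - e j) < n.+1%:R^-1]); apply: F_C_ball => //; rewrite invr_gt0.
  have [h|h] := ltP 0 (t - n.+1%:R^-1).
    by apply: (m2 [set y | N (y - (x - e j)) < t - n.+1%:R^-1]); exact: F_C_ball.
  rewrite (_ : [set _ | _] = set0)//; apply/seteqP; split=> // w /= hw.
  by move: hw; rewrite ltNge (le_trans h (seminorm_ge0 _ sN)).
rewrite (_ : [set _ | _] = \bigcup_j \bigcup_n E j n); last first.
  apply/seteqP; split=> [w /= hw|w [j _ [n _ []]] /= h1 h2].
    set r := N (Z1 w + Z2 w - x) in hw.
    have tr : 0 < (t - r) / 2 by rewrite divr_gt0// subr_gt0.
    pose n := Num.truncn ((t - r) / 2)^-1.
    have n0 : 0 < n.+1%:R^-1 :> R by rewrite invr_gt0.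
    have nt : n.+1%:R^-1 < (t - r) / 2.
      by rewrite invf_plt ?posrE//; exact: truncnS_gt.
    have [j hj] := he (Z1 w) _ n0; exists j => //; exists n => //; split=> //=.
    have -> : Z2 w - (x - e j) = (Z1 w + Z2 w - x) + - (Z1 w - e j).
      by rewrite !opprB -[Z1 w + Z2 w - x]addrA [RHS]addrC [RHS]addrA subrK addrCA.
    apply: le_lt_trans (sN.1 _ _) _; rewrite (seminormN _ sN) -/r.
    move: hj nt; set s := n.+1%:R^-1; set y := N _; lra.
  have -> : Z1 w + Z2 w - x = (Z1 w - e j) + (Z2 w - (x - e j)).
    by rewrite opprB [Z2 w + (e j - x)]addrCA [RHS]addrA subrK addrA.
  apply: le_lt_trans (sN.1 _ _) _.
  move: h1 h2; set s := n.+1%:R^-1; lra.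
by apply: bigcup_measurable => j _; exact: bigcup_measurable.
Qed.

Lemma rv_measurable_sum (Y : nat -> Omega -> X) n :
  (forall i, rv_measurable (F_C Cs) (Y i)) ->
  rv_measurable (F_C Cs) (fun w => \sum_(i < n) Y i w).
Proof.
move=> mY; elim: n => [|n IH].
  rewrite (_ : (fun _ => _) = cst 0); first exact: rv_measurable_cst.
  by apply/funext => w; rewrite big_ord0.
rewrite (_ : (fun _ => _) = fun w => \sum_(i < n) Y i w + Y n w).
  exact: rv_measurableD.
by apply/funext => w; rewrite big_ord_recr.
Qed.

Lemma rv_measurable_mean_seq (Y : nat -> Omega -> X) n :
  (forall i, rv_measurable (F_C Cs) (Y i)) -> rv_measurable (F_C Cs) (mean_seq Y n).
Proof.
move=> mY; case: n => [|n].
  (* The mean of the empty sample is 0. *)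
  rewrite (_ : mean_seq Y 0 = cst 0); first exact: rv_measurable_cst.
  by apply/funext => w; rewrite /mean_seq big_ord0 scaler0.
apply: rv_measurable_balls => N x t gN t0; have [sN _ _] := gN.
have n0 : 0 < n.+1%:R :> R by [].
rewrite (_ : [set _ | _] = (fun w => \sum_(i < n.+1) Y i w) @^-1`
    [set y | N (y - n.+1%:R *: x) < n.+1%:R * t]).
  by apply: rv_measurable_sum => //; apply: F_C_ball => //; rewrite mulr_gt0.
apply/funext => w /=; congr (is_true _).
rewrite -(ltr_pM2l n0); congr (_ < _).
rewrite -[X in X * _]gtr0_norm// -sN.2 scalerBr /mean_seq scalerA divff ?scale1r//.
Qed.

Lemma measurable_fun_dual (lam : X -> R) N B Z : admissible Cs N -> dual_ball N B lam ->
  rv_measurable (F_C Cs) Z -> measurable_fun setT (lam \o Z).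
Proof.
move=> gN [llin lN] mZ; have [sN _ _] := gN.
apply: (measurability _ (RGenOInfty.measurableE R)) => _ [_ [a ->] <-].
rewrite setTI comp_preimage; apply: mZ; apply: F_C_open gN _ => x /=.
rewrite in_itv /= andbT => ax.
(* A positive Lipschitz constant for [lam], whatever the sign of [B]. *)
have B1 : 0 < `|B| + 1 by rewrite ltr_wpDl.
exists ((lam x - a) / (`|B| + 1)); first by rewrite divr_gt0// subr_gt0.
move=> y /=; rewrite ltr_pdivlMr// => hy; rewrite in_itv /= andbT.
suff : lam x - lam y < lam x - a by lra.
apply: le_lt_trans hy; rewrite -(linear_formB llin).
apply: le_trans (ler_norm _) _; apply: le_trans (lN _) _.
rewrite -(seminormN _ sN) opprB mulrC.
by apply: ler_wpM2l; [exact: seminorm_ge0|rewrite (le_trans (ler_norm _))// lerDl].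
Qed.

End Measurability.

(** * Discretisation of the sample into words *)

Section WordEvents.
Context {R : realType} {X : lmodType R} (Cs : set (set X)).
Hypothesis hCs : forall C, Cs C ->
  [/\ symmetric_set C, algebraically_open C, is_convex_set C, C 0 & tau_separable C].
Context {d : measure_display} {Omega : measurableType d} (P : probability Omega R).
Context (Y : nat -> Omega -> X) (hY : iid P (F_C Cs) Y).
Context (N : X -> R) (gN : admissible Cs N) (e : nat -> X) (dl : R) (dl0 : 0 < dl).
Hypothesis e_dense : forall x, exists j, N (x - e j) < dl.

Let sN : seminorm N. Proof. by case: gN. Qed.
Let mY i : rv_measurable (F_C Cs) (Y i). Proof. by case: hY. Qed.

(** The balls around the dense points made disjoint, so that each sample point has exactly one
    letter. *)
Definition cell : nat -> set X := seqDU (fun j => [set y | N (y - e j) < dl]).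

Definition cell_prob (j : nat) : R := fine (P (Y 0%N @^-1` cell j)).

Lemma F_C_cell j : F_C Cs (cell j).
Proof. by apply: F_C_seqDU => n; exact: F_C_ball. Qed.

Lemma cell_lt j y : cell j y -> N (y - e j) < dl.
Proof. by case. Qed.

Lemma cell_cover y : exists j, cell j y.
Proof.
have [j hj] := e_dense y.
have : (\bigcup_j cell j) y by rewrite -seqDU_bigcup_eq; exists j.
by case=> i _; exists i.
Qed.

Lemma cell_inj i j y : cell i y -> cell j y -> i = j.
Proof.
move=> ci cj; apply: (@trivIset_seqDU _ (fun j => [set y | N (y - e j) < dl]) i j) => //.
by exists y.
Qed.

Let mcell i j : measurable (Y i @^-1` cell j).
Proof. by apply: mY; exact: F_C_cell. Qed.

Lemma cell_probE i j : P (Y i @^-1` cell j) = (cell_prob j)%:E.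
Proof.
have [_ id _] := hY; rewrite id; last exact: F_C_cell.
by rewrite /cell_prob fineK// fin_num_measure.
Qed.

Lemma cell_prob_ge0 j : 0 <= cell_prob j.
Proof. by apply: fine_ge0; exact: measure_ge0. Qed.

Lemma trivIset_cell i : trivIset setT (fun j => Y i @^-1` cell j).
Proof. by move=> j k _ _ [w [/= hj hk]]; exact: cell_inj hj hk. Qed.

Lemma sum_cell_prob_le1 k : \sum_(j < k) cell_prob j <= 1.
Proof.
rewrite -lee_fin -sumEFin.
under eq_bigr => j _ do rewrite -(cell_probE 0).
rewrite -(measure_bigsetU P (fun j => mcell 0 j) (@trivIset_cell 0%N)).
by apply: probability_le1; apply: bigsetU_measurable => j _.
Qed.

Definition cylinder (u : seq nat) : set Omega :=
  [set w | forall i, (i < size u)%N -> cell (nth 0%N u i) (Y i w)].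

Lemma cylinderE u :
  cylinder u = \bigcap_(i in [set` iota 0 (size u)]) (Y i @^-1` cell (nth 0%N u i)).
Proof.
by apply/seteqP; split=> w h i; have := h i; rewrite /= mem_iota add0n.
Qed.

Lemma measurable_cylinder u : measurable (cylinder u).
Proof.
rewrite cylinderE; apply: fin_bigcap_measurable => //.
Qed.

Lemma cylinder_prob u : P (cylinder u) = (\prod_(j <- u) cell_prob j)%:E.
Proof.
rewrite cylinderE; have [_ _ ->] := hY; last 2 first.
- exact: iota_uniq.
- by move=> i; exact: F_C_cell.
rewrite (eq_bigr (fun i => (cell_prob (nth 0%N u i))%:E)) => [|i _]; last first.
  exact: cell_probE.
by rewrite prodEFin [in RHS](big_nth 0%N) /index_iota subn0.
Qed.

Lemma cylinder_rcons u j w : cylinder (rcons u j) w -> cell j (Y (size u) w).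
Proof. by move=> /(_ (size u)); rewrite size_rcons nth_rcons ltnn eqxx; apply. Qed.

Lemma cylinder_cat u v w : cylinder (u ++ v) w -> cylinder u w.
Proof.
move=> h i iu; have := h i; rewrite size_cat nth_cat iu; apply.
by rewrite ltn_addr.
Qed.

(* The event that the cells visited by [Y 0, ..., Y (size u + m - 1)] spell a word
   [u ++ v] satisfying [S], with [v] of length [m] in the letters below [k]. *)
Fixpoint word_event (S : pred (seq nat)) (k : nat) (u : seq nat) (m : nat) : set Omega :=
  if m is m'.+1 then \big[setU/set0]_(j < k) word_event S k (rcons u j) m'
  else if S u then cylinder u else set0.

Lemma word_eventP S k u m w : word_event S k u m w <->
  exists v, [/\ word k m v, S (u ++ v) & cylinder (u ++ v) w].
Proof.
elim: m u => [|m IH] u /=.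
  split=> [|[v [/andP[/eqP/size0nil-> _]]]]; last by rewrite cats0 => ->.
  by case: ifP => // Su cu; exists [::]; rewrite cats0.
rewrite -(bigcup_mkord k (fun j => word_event S k (rcons u j) m)).
split=> [[j /= jk /IH[v [/andP[sv av] Sv cv]]]|].
  exists (j :: v); rewrite -cat_rcons; split=> //.
  by rewrite /word /= eqSS sv jk.
move=> [[|j v] [/andP[//= sv /andP[jk av]] Sv cv]]; exists j => //.
by apply/IH; exists v; rewrite cat_rcons; split=> //; rewrite /word -eqSS sv.
Qed.

Lemma measurable_word_event S k u m : measurable (word_event S k u m).
Proof.
elim: m u => [|m IH] u /=; first by case: ifP => // _; exact: measurable_cylinder.
exact: bigsetU_measurable.
Qed.

Lemma word_event_prob S k u m : P (word_event S k u m) =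
  (\prod_(j <- u) cell_prob j * wordE cell_prob k m (fun v => (S (u ++ v))%:R))%:E.
Proof.
elim: m u => [|m IH] u /=.
  rewrite cats0; case: ifP => _; first by rewrite mulr1 cylinder_prob.
  by rewrite mulr0 measure0.
rewrite (measure_bigsetU P (F := fun j => word_event S k (rcons u j) m)).
- rewrite mulr_sumr -sumEFin; apply: eq_bigr => j _; rewrite [LHS]IH.
  rewrite big_rcons/= -mulrA; congr (_ * (_ * _))%:E.
  by apply: eq_wordE => v _; rewrite cat_rcons.
- by move=> j; exact: measurable_word_event.
move=> i j _ _ [w [/word_eventP[v [_ _ cv]] /word_eventP[v' [_ _ cv']]]].
apply: (@cell_inj _ _ (Y (size u) w)); apply: cylinder_rcons.
  exact: cylinder_cat cv.
exact: cylinder_cat cv'.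
Qed.

Lemma word_event_nondecreasing S u m :
  nondecreasing_seq (fun k => word_event S k u m).
Proof.
move=> k k' kk'; apply/subsetPset => w /word_eventP[v [/andP[sv av] Sv cv]].
apply/word_eventP; exists v; split=> //; rewrite /word sv /=.
by apply: sub_all av => j jk; exact: leq_trans kk'.
Qed.

Lemma cylinder_exists m w : exists2 v, size v = m & cylinder v w.
Proof.
have [c hc] := choice (fun i => cell_cover (Y i w)).
exists (mkseq c m); first by rewrite size_mkseq.
by move=> i; rewrite size_mkseq => im; rewrite nth_mkseq.
Qed.

Definition ball_prob (x : X) (m : nat) (t : R) : R :=
  fine (P (mean_seq Y m @^-1` [set y | N (y - x) < t])).

Let ball_event x m t : (0 < m)%N -> mean_seq Y m @^-1` [set y | N (y - x) < t] =
  [set w | N (\sum_(i < m) (Y i w - x)) < m%:R * t].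
Proof.
move=> m0; have mR : 0 < m%:R :> R by rewrite ltr0n.
apply/funext => w /=; congr (is_true _).
rewrite -(ltr_pM2l mR); congr (_ < _).
rewrite -[X in X * _]gtr0_norm// -sN.2 scalerBr /mean_seq scalerA divff ?gt_eqF// scale1r.
by rewrite sumrB sumr_const card_ord scaler_nat.
Qed.

Let cylinder_close x v w : cylinder v w -> (0 < size v)%N ->
  N (\sum_(i < size v) (Y i w - x) - \sum_(j <- v) (e j - x)) < (size v)%:R * dl.
Proof.
move=> cv v0; rewrite (big_nth 0%N) big_mkord -sumrB.
(* The induction starts at [n = 1], the strict inequality being false for the empty sum. *)
have Nlt n : (0 < n <= size v)%N ->
    N (\sum_(i < n) (Y i w - x - (e (nth 0%N v i) - x))) < n%:R * dl.
  elim: n => // -[_|n IH] /andP[_ nv].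
    rewrite big_ord_recr big_ord0 /= add0r mul1r opprB addrA subrK.
    exact: cell_lt (cv _ nv).
  rewrite big_ord_recr /= -natr1 mulrDl mul1r; apply: le_lt_trans (sN.1 _ _) _.
  apply: ltrD; first by apply: IH; exact: ltnW.
  by rewrite /= opprB addrA subrK; exact: cell_lt (cv _ nv).
by apply: Nlt; rewrite v0 leqnn.
Qed.

Let measurable_ball x m t : 0 < t ->
  measurable (mean_seq Y m @^-1` [set y | N (y - x) < t]).
Proof.
by move=> t0; apply: (rv_measurable_mean_seq hCs) mY _ _; exact: F_C_ball.
Qed.

Lemma wordE_le_ball_prob k x m t : (0 < m)%N -> 0 < t ->
  wordE cell_prob k m (fun v => (N (\sum_(j <- v) (e j - x)) < m%:R * t)%R%:R) <=
  ball_prob x m (t + dl).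
Proof.
move=> m0 t0; pose S (v : seq nat) := N (\sum_(j <- v) (e j - x)) < m%:R * t.
have := word_event_prob S k [::] m; rewrite big_nil mul1r /= => PE.
have td : 0 < t + dl by rewrite addr_gt0.
rewrite -lee_fin -PE /ball_prob fineK ?fin_num_measure//; last exact: measurable_ball.
apply: le_measure; rewrite ?inE.
- exact: measurable_word_event.
- exact: measurable_ball.
rewrite ball_event// => w /word_eventP[v [/andP[/eqP sv _] Sv cv]] /=.
have := cylinder_close x cv; rewrite sv => /(_ m0) h.
rewrite -[X in N X](subrK (\sum_(j <- v) (e j - x))) mulrDr addrC.
by apply: le_lt_trans (sN.1 _ _) _; rewrite ltrD.
Qed.

(** Each sample spells a word over some finite alphabet, so the word events increase with [k] to an
    event containing the one about the ball; continuity from below passes the bound to the limit. *)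
Lemma ball_prob_le x m t (c : R) : (0 < m)%N -> 0 < t ->
  (forall k, wordE cell_prob k m
    (fun v => (N (\sum_(j <- v) (e j - x)) < m%:R * (t + dl))%R%:R) <= c) ->
  ball_prob x m t <= c.
Proof.
move=> m0 t0 hc; pose S (v : seq nat) := N (\sum_(j <- v) (e j - x)) < m%:R * (t + dl).
rewrite -lee_fin /ball_prob fineK ?fin_num_measure//; last exact: measurable_ball.
have mU : measurable (\bigcup_k word_event S k [::] m).
  by apply: bigcup_measurable => k _; exact: measurable_word_event.
apply: (@le_trans _ _ (P (\bigcup_k word_event S k [::] m))).
  apply: le_measure; rewrite ?inE//; first exact: measurable_ball.
  rewrite ball_event// => w /= hw.
  have [v sv cv] := cylinder_exists m w.
  (* Letters must be strictly below the size of the alphabet, hence the successor. *)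
  exists (\max_(j <- v) j).+1 => //; apply/word_eventP; exists v; split=> //.
    rewrite /word sv eqxx /=; apply/allP => j jv.
    by rewrite ltnS (big_rem j) //= leq_maxl.
  have := cylinder_close x cv; rewrite sv => /(_ m0) h; rewrite /S /= mulrDr.
  have -> : \sum_(j <- v) (e j - x) = \sum_(i < m) (Y i w - x) +
      - (\sum_(i < m) (Y i w - x) - \sum_(j <- v) (e j - x)).
    by rewrite opprB addrCA subrr addr0.
  by apply: le_lt_trans (sN.1 _ _) _; rewrite (seminormN _ sN) ltrD.
have cvg_event : P \o (fun k => word_event S k [::] m) @ \oo -->
    P (\bigcup_k word_event S k [::] m).
  apply: nondecreasing_cvg_mu => //; last exact: word_event_nondecreasing.
  by move=> k; exact: measurable_word_event.
rewrite -(cvg_lim (@ereal_hausdorff R) cvg_event).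
apply: lime_le; first by apply/cvg_ex; eexists; exact: cvg_event.
apply: nearW => k /=; rewrite word_event_prob big_nil mul1r lee_fin.
exact: hc.
Qed.

(** * Exponential moments of the discretised law *)

Section ExponentialMoment.
Context (lam : X -> R) (B : R) (lamB : dual_ball N B lam) (B0 : 0 <= B).

Let llin : linear_form lam. Proof. by case: lamB. Qed.

Let mexp : measurable_fun setT (fun w => (expR (lam (Y 0%N w)))%:E).
Proof.
apply/measurable_EFinP.
exact: (measurableT_comp (@measurable_expR R) (measurable_fun_dual gN lamB (mY 0))).
Qed.

Let close j y : cell j y -> `|lam y - lam (e j)| <= B * dl.
Proof.
move=> cj; rewrite -(linear_formB llin); case: lamB => _ h.
by apply: le_trans (h _) _; rewrite ler_wpM2l// ltW// cell_lt.
Qed.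

Let split_integral : (\int[P]_w (expR (lam (Y 0%N w)))%:E =
  \sum_(j <oo) \int[P]_(w in Y 0%N @^-1` cell j) (expR (lam (Y 0%N w)))%:E)%E.
Proof.
have cover : [set: Omega] = \bigcup_j (Y 0%N @^-1` cell j).
  apply/seteqP; split=> // w _; have [j cj] := cell_cover (Y 0%N w).
  by exists j.
rewrite [in LHS]cover ge0_integral_bigcup//.
- by rewrite -cover.
- exact: trivIset_cell.
Qed.

Let mexpj j : measurable_fun (Y 0%N @^-1` cell j)
  (fun w => (expR (lam (Y 0%N w)))%:E).
Proof. exact: measurable_funTS mexp. Qed.

(** On a cell, [lam] differs from its value at the center by at most [B * dl]; the integral is
    summed over the countably many cells. *)
Lemma expectation_le (c : R) :
  (forall k, wexp cell_prob e k lam <= c) ->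
  (\int[P]_w (expR (lam (Y 0%N w)))%:E <= (expR (B * dl) * c)%:E)%E.
Proof.
move=> hc; rewrite split_integral; apply: lime_le.
  by apply: is_cvg_nneseries => j _ _; apply: integral_ge0 => w _; rewrite lee_fin expR_ge0.
apply: nearW => k; rewrite big_mkord.
apply: (@le_trans _ _ (\sum_(j < k) (expR (B * dl) * (cell_prob j * expR (lam (e j))))%:E)%E).
  apply: lee_sum => j _.
  apply: (@le_trans _ _ (\int[P]_(w in Y 0%N @^-1` cell j)
      (cst (expR (B * dl) * expR (lam (e j)))%:E) w)%E).
    apply: ge0_le_integral => //.
    move=> w /= cj; rewrite lee_fin -expRD ler_expR -lerBlDr.
    by apply: le_trans (ler_norm _) _; exact: close.
  by rewrite integral_cst// [X in (_ * X)%E](cell_probE 0%N j : _ = _) -EFinM lee_fin mulrA mulrAC.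
rewrite sumEFin lee_fin -mulr_sumr ler_wpM2l ?expR_ge0//.
exact: hc.
Qed.

Lemma wexp_le_expectation (c : R) k :
  (\int[P]_w (expR (lam (Y 0%N w)))%:E <= c%:E)%E ->
  wexp cell_prob e k lam <= expR (B * dl) * c.
Proof.
rewrite split_integral => hc.
rewrite -[leLHS]mul1r -(expR0 R) -[X in expR X](subrr (B * dl)) expRD -mulrA.
rewrite ler_wpM2l ?expR_ge0// -lee_fin; apply: le_trans hc.
apply: le_trans (nneseries_lim_ge k _) => /=; last first.
  by move=> j _ _; apply: integral_ge0 => w _; rewrite lee_fin expR_ge0.
rewrite big_mkord /wexp mulr_sumr -sumEFin; apply: lee_sum => j _.
apply: (@le_trans _ _ (\int[P]_(w in Y 0%N @^-1` cell j)
    (cst (expR (- (B * dl)) * expR (lam (e j)))%:E) w)%E).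
  by rewrite integral_cst// [X in (_ * X)%E](cell_probE 0%N j : _ = _) -EFinM lee_fin [cell_prob j * _]mulrC mulrA.
apply: ge0_le_integral => //.
  by move=> w _; rewrite lee_fin mulr_ge0// expR_ge0.
move=> w /= cj; rewrite lee_fin -expRD ler_expR addrC.
by have := close cj; rewrite ler_norml => /andP[+ _]; lra.
Qed.

End ExponentialMoment.

End WordEvents.

(** * Extended reals and exponential growth rates *)

Section GrowthRates.
Context {R : realType}.
Local Open Scope ereal_scope.
Implicit Types (u v : (\bar R)^nat) (x y : \bar R).

Lemma lt_ereal_real x y : x < y -> exists r : R, x < r%:E /\ r%:E < y.
Proof.
case: x y => [a| |] [b| |] // h.
- by exists ((a + b) / 2)%R; rewrite !lte_fin midf_lt// midf_lt.
- by exists (a + 1)%R; rewrite lte_fin ltrDl ltry.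
- by exists (b - 1)%R; rewrite lte_fin gtrBl ltNyr.
- by exists 0%R; rewrite ltNyr ltry.
Qed.

Lemma le_ereal_real x y : (forall r : R, y < r%:E -> x <= r%:E) -> x <= y.
Proof.
move=> h; rewrite leNgt; apply/negP => /lt_ereal_real[r [yr rx]].
by have := h r yr; rewrite leNgt rx.
Qed.

Lemma limn_einf_ge u x n0 : (forall n, (n0 <= n)%N -> x <= u n) -> x <= limn_einf u.
Proof.
move=> h; rewrite limn_einf_lim; apply: lime_ge; first exact: is_cvg_einfs.
exists n0 => // n /= nn; apply: le_ereal_inf_tmp => _ [k /= nk <-].
by apply: h; exact: leq_trans nk.
Qed.

Lemma limn_esup_le u x n0 : (forall n, (n0 <= n)%N -> u n <= x) -> limn_esup u <= x.
Proof.
move=> h; rewrite limn_esup_lim; apply: lime_le; first exact: is_cvg_esups.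
exists n0 => // n /= nn; apply: ge_ereal_sup => _ [k /= nk <-].
by apply: h; exact: leq_trans nk.
Qed.

Lemma le_limn_einf u v : (forall n, u n <= v n) -> limn_einf u <= limn_einf v.
Proof.
move=> uv; rewrite !limn_einf_lim.
apply: lee_lim; [exact: is_cvg_einfs|exact: is_cvg_einfs|].
apply: nearW => n; apply: le_ereal_inf_tmp => _ [k nk <-].
by apply: le_trans (uv k); apply: ereal_inf_lbound; exists k.
Qed.

Lemma lne_le_mono x y : 0 <= x -> x <= y -> lne x <= lne y.
Proof.
by move=> x0 xy; rewrite lee_lne// in_itv /= leey andbT// (le_trans x0).
Qed.

Lemma lne_expR (r : R) : lne (expR r)%:E = r%:E.
Proof. by rewrite lne_EFin ?expR_gt0// expRK. Qed.

Lemma log_rate_le x (b : R) n : (0 < n)%N -> 0 <= x -> x <= (expR (n%:R * b))%:E ->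
  (n%:R^-1)%:E * lne x <= b%:E.
Proof.
move=> n0 x0 /(lne_le_mono x0); rewrite lne_expR => h.
have nR : (0 < n%:R :> R)%R by rewrite ltr0n.
by rewrite lee_pdivrMl// -EFinM.
Qed.

Lemma log_rate_ge x (b : R) n : (0 < n)%N -> (expR (n%:R * b))%:E <= x ->
  b%:E <= (n%:R^-1)%:E * lne x.
Proof.
move=> n0 h; have nR : (0 < n%:R :> R)%R by rewrite ltr0n.
by rewrite lee_pdivlMl// -EFinM -lne_expR; apply: lne_le_mono.
Qed.

End GrowthRates.

(** * Probabilities that the mean lies in a ball *)

Section BallEstimates.
Context {R : realType} {X : lmodType R} (Cs : set (set X)).
Hypothesis hCs : forall C, Cs C ->
  [/\ symmetric_set C, algebraically_open C, is_convex_set C, C 0 & tau_separable C].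
Context {d : measure_display} {Omega : measurableType d} (P : probability Omega R).
Context (Y : nat -> Omega -> X) (hY : iid P (F_C Cs) Y).
Context (N : X -> R) (gN : admissible Cs N) (x : X).

Local Notation bp := (ball_prob P Y N x).

Let sN : seminorm N. Proof. by case: gN. Qed.

Lemma ball_prob_superadditive m (t t' c : R) :
  (0 < m)%N -> 0 < t -> t < t' -> 0 < c -> c < bp m t ->
  exists2 kap, 0 < kap & exists n0, forall n, (n0 <= n)%N -> c ^+ (n %/ m) * kap <= bp n t'.
Proof.
move=> m0 t0 tt' c0 cm; have [_ [e he] _] := gN.
(* One third of the gap pays for passing to words, one for completing the blocks, and one for
   returning to the sample. *)
pose dl := (t' - t) / 3; have dl0 : 0 < dl by rewrite divr_gt0// subr_gt0.
have dense y := he y dl dl0.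
pose q := cell_prob P Y N e dl; have q0 j : 0 <= q j := cell_prob_ge0 P Y N e dl j.
pose W k n s := wordE q k n (fun w => (N (\sum_(j <- w) (e j - x)) < n%:R * s)%R%:R).
have [k hk] : exists k, c < W k m (t + dl).
  apply: contrapT => h; move: cm; apply/negP; rewrite -leNgt.
  apply: (ball_prob_le hCs hY gN dl0 dense m0 t0) => k.
  by rewrite leNgt; apply/negP => ck; apply: h; exists k.
have [j jk qj] := wordE_gt0_letter q0 m0 (lt_trans c0 hk).
have q1 : q j <= 1.
  apply: le_trans (sum_cell_prob_le1 hY gN e dl0 k).
  by rewrite (bigD1 (Ordinal jk)) //= lerDl; exact: sumr_ge0.
have tdl : 0 < t + dl by rewrite addr_gt0.
have tdl2 : t + dl < t + dl + dl by rewrite ltrDl.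
have [n0 hn0] := wordE_superadditive (fun j => e j - x) sN q0 jk m0 tdl tdl2.
(* Since [q j <= 1], this bounds [q j ^+ (n %% m)] from below uniformly in [n]. *)
exists (q j ^+ m); first by rewrite exprn_gt0.
exists (maxn n0 1) => n; rewrite geq_max => /andP[n0n n1].
have -> : t' = t + dl + dl + dl by rewrite /dl; field.
apply: le_trans (wordE_le_ball_prob hCs hY gN e dl0 k x n1 (addr_gt0 tdl dl0)).
apply: le_trans (hn0 n n0n); apply: ler_pM; [exact: exprn_ge0 (ltW c0)|exact: exprn_ge0 (q0 j)| |].
  by rewrite lerXn2r ?nnegrE ?(ltW c0) ?(ltW (lt_trans c0 hk))// ltW.
by apply: ler_wiXn2l => //; rewrite ltnW// ltn_mod.
Qed.

Let measurable_ball_event m (t : R) : 0 < t ->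
  measurable (mean_seq Y m @^-1` [set y | N (y - x) < t]).
Proof.
by move=> t0; apply: (rv_measurable_mean_seq hCs); [case: hY|exact: F_C_ball].
Qed.

Let ball_probE m (t : R) : 0 < t ->
  (bp m t)%:E = P (mean_seq Y m @^-1` [set y | N (y - x) < t]).
Proof.
by move=> t0; rewrite /ball_prob fineK// fin_num_measure//; exact: measurable_ball_event.
Qed.

Lemma ball_prob_le1 m (t : R) : 0 < t -> bp m t <= 1.
Proof.
move=> t0; rewrite -lee_fin ball_probE//.
by apply: probability_le1; exact: measurable_ball_event.
Qed.

(* Subadditivity turns the lower growth rate into a bound valid for every [m]. *)
Lemma ball_prob_le_expR (b t t' : R) : 0 < t -> t < t' ->
  (limn_einf (log_prob_seq P Y [set y | (N (y - x) < t')%R]) < b%:E)%E ->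
  forall m, (0 < m)%N -> bp m t <= expR b ^+ m.
Proof.
move=> t0 tt' hb m m0; rewrite leNgt; apply/negP => hm.
have mR : 0 < m%:R :> R by rewrite ltr0n.
have p0 : 0 < bp m t by apply: lt_trans hm; rewrite exprn_gt0 ?expR_gt0.
have bln : m%:R * b < ln (bp m t).
  by rewrite -ltr_expR lnK// expRM_natl.
(* A rate strictly between [b] and the one observed at [m]; the margin [s - b] absorbs the constant
   [kap] for large [n]. *)
pose s := (b + ln (bp m t) / m%:R) / 2.
have bs : b < s by rewrite /s midf_lt// ltr_pdivlMr// mulrC.
have sl : m%:R * s < ln (bp m t).
  have -> : m%:R * s = (m%:R * b + ln (bp m t)) / 2 by rewrite /s; field; rewrite gt_eqF.
  lra.
have l0 : ln (bp m t) <= 0 by apply: ln_le0; exact: ball_prob_le1.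
(* The sign lets the exponent [n %/ m * m] be replaced by the larger [n]. *)
have s0 : s < 0 by rewrite -(pmulr_rlt0 _ mR); exact: lt_le_trans sl l0.
have [kap kap0 [n0 hn0]] : exists2 kap, 0 < kap & exists n0, forall n, (n0 <= n)%N ->
    expR (m%:R * s) ^+ (n %/ m) * kap <= bp n t'.
  apply: (ball_prob_superadditive m0 t0 tt'); first exact: expR_gt0.
  by rewrite -[ltRHS]lnK// ltr_expR.
move: hb; apply/negP; rewrite -leNgt.
apply: (@limn_einf_ge _ _ _ (maxn n0 (Num.truncn (- ln kap / (s - b))).+1)) => n.
rewrite geq_max => /andP[n0n nk]; have n1 : (0 < n)%N by exact: leq_ltn_trans nk.
apply: log_rate_ge => //.
rewrite -ball_probE ?(lt_trans t0)//.
rewrite lee_fin; apply: le_trans (hn0 n n0n).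
rewrite -expRM_natl -[kap]lnK// -expRD ler_expR mulrA -natrM.
have h1 : n%:R * s <= (n %/ m * m)%:R * s by rewrite ler_wnM2r ?(ltW s0)// ler_nat leq_trunc_div.
have h2 : - ln kap <= n%:R * (s - b).
  rewrite -ler_pdivrMr ?subr_gt0//; apply/ltW/(lt_le_trans (truncnS_gt _)).
  by rewrite ler_nat.
nra.
Qed.

Lemma exists_dual_expectation_le (a t eps : R) : 0 < a -> 0 < t -> 0 < eps ->
  (forall m, (0 < m)%N -> bp m t <= expR (- a) ^+ m) ->
  exists2 lam, dual_space Cs lam &
    (\int[P]_w (expR (lam (Y 0%N w)))%:E <= (expR (lam x - a + eps))%:E)%E.
Proof.
move=> a0 t0 eps0 hm; have [_ [e he] _] := gN.
(* The first bound keeps the radius [r] at least [t / 2]; with the second, the discretisation error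
   [a / r * dl] of the exponent is at most [eps]. *)
pose dl := Num.min (t / 2) (eps * t / (2 * a)).
have dl0 : 0 < dl by rewrite lt_min !divr_gt0// ?mulr_gt0.
have dlt : dl <= t / 2 by rewrite ge_min lexx.
have dle : dl <= eps * t / (2 * a) by rewrite ge_min lexx orbT.
have dense y := he y dl dl0.
pose r := t - dl; have r0 : 0 < r by rewrite /r; lra.
have [lam lamB hlam] := exists_wexp_le_all (v := fun j => e j - x) sN
  (cell_prob_ge0 P Y N e dl) (sum_cell_prob_le1 hY gN e dl0) (ltW a0) r0
  (fun k m m0 => le_trans (wordE_le_ball_prob hCs hY gN e dl0 k x m0 r0)
    (eq_ind_r (fun s => bp m s <= _) (hm m m0) (subrK dl t))).
have [llin _] := lamB.
exists lam; first exact: dual_space_dual_ball gN lamB.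
have B0 : 0 <= a / r by rewrite divr_ge0// ltW.
have hw k : wexp (cell_prob P Y N e dl) e k lam <= expR (lam x - a).
  rewrite expRD -ler_pdivrMl ?expR_gt0// -expRN.
  apply: le_trans (hlam k); rewrite /wexp mulr_sumr; apply: ler_sum => j _.
  by rewrite (linear_formB llin) expRD mulrCA [expR (lam (e j)) * _]mulrC.
apply: le_trans (expectation_le hY gN dl0 dense lamB B0 hw) _.
rewrite lee_fin -expRD ler_expR addrC lerD2l.
rewrite mulrAC ler_pdivrMr// -ler_pdivlMl//.
apply: (le_trans dle).
have -> : eps * t / (2 * a) = a^-1 * (eps * (t / 2)) by field; rewrite gt_eqF.
by rewrite ler_pM2l ?invr_gt0// ler_pM2l// /r; lra.
Qed.

(** Exponential Markov inequality on words with cells of radius [t]. The radius of the word ball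
    costs [2 * t] per letter, and replacing the expectation by a sum over cells costs [t]. *)
Lemma ball_prob_chernoff (lam : X -> R) (b t : R) m : dual_ball N 1 lam ->
  (0 < m)%N -> 0 < t ->
  (\int[P]_w (expR (lam (Y 0%N w)))%:E <= (expR (b + lam x))%:E)%E ->
  bp m t <= expR (b + 3 * t) ^+ m.
Proof.
move=> lamB m0 t0 hb; have [_ [e he] _] := gN; have [llin lN] := lamB.
have dense y := he y t t0.
apply: (ball_prob_le hCs hY gN t0 dense m0 t0) => k.
have q0 j : 0 <= cell_prob P Y N e t j by exact: cell_prob_ge0.
have hk := wexp_le_expectation hY gN t0 dense lamB ler01 k hb.
apply: (@le_trans _ _ (wordE (cell_prob P Y N e t) k m (fun w =>
    \prod_(j <- w) (expR (lam (e j)) * expR (2 * t - lam x)) * 1))).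
  apply: le_wordE => // w /andP[/eqP sw _]; rewrite mulr1.
  have -> : \prod_(j <- w) (expR (lam (e j)) * expR (2 * t - lam x)) =
      expR (lam (\sum_(j <- w) (e j - x)) + m%:R * (2 * t)).
    rewrite (linear_form_sum llin) -sw; elim: (w) => [|j u IH].
      by rewrite !big_nil mul0r addr0 expR0.
    rewrite !big_cons IH -!expRD /= -nat1r (linear_formB llin); congr expR; ring.
  have [hN|_] := ltP; last exact: expR_ge0.
  apply: (@le_trans _ _ (expR 0)); first by rewrite expR0.
  rewrite ler_expR; have := lN (\sum_(j <- w) (e j - x)).
  rewrite mul1r ler_norml => /andP[h _].
  have : m%:R * (t + t) = m%:R * (2 * t) by ring.
  lra.
rewrite -wordE_reweight wordE1 lerXn2r//.
- by rewrite nnegrE; apply: sumr_ge0 => j _; rewrite !mulr_ge0 ?expR_ge0.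
- by rewrite nnegrE expR_ge0.
under eq_bigr => j _ do rewrite mulrA.
rewrite -mulr_suml; apply: (@le_trans _ _ (expR (1 * t) * expR (b + lam x) * expR (2 * t - lam x))).
  by rewrite ler_wpM2r ?expR_ge0.
rewrite -!expRD ler_expR; lra.
Qed.

End BallEstimates.

(** * The large deviation bounds and the entropy *)

Section LargeDeviations.
Context {R : realType} {X : lmodType R} (Cs : set (set X)).
Hypothesis hCs : forall C, Cs C ->
  [/\ symmetric_set C, algebraically_open C, is_convex_set C, C 0 & tau_separable C].
Context {d : measure_display} {Omega : measurableType d} (P : probability Omega R).
Context (Y : nat -> Omega -> X) (hY : iid P (F_C Cs) Y).

Let measurable_mean n A : F_C Cs A -> measurable (mean_seq Y n @^-1` A).
Proof. by move=> FA; apply: (rv_measurable_mean_seq hCs) => //; case: hY. Qed.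

Lemma le_log_prob_seq A B n : F_C Cs A -> F_C Cs B -> A `<=` B ->
  (log_prob_seq P Y A n <= log_prob_seq P Y B n)%E.
Proof.
move=> FA FB AB; apply: lee_wpmul2l; first by rewrite lee_fin invr_ge0.
apply: lne_le_mono; first exact: measure_ge0.
by apply: le_measure; rewrite ?inE; [exact: measurable_mean|exact: measurable_mean|
  move=> w /AB].
Qed.

(** The neighbourhood that witnesses the infimum is a unit ball, and shrinking it to radius 1/2
    upgrades a lower limit to a bound valid for every sample size. *)
Lemma entropy_lt x (b : R) : (entropy P Cs Y x < b%:E)%E ->
  exists2 N, admissible Cs N &
    forall m, (0 < m)%N -> ball_prob P Y N x m (1 / 2) <= expR b ^+ m.
Proof.
move=> /ereal_inf_lt[_ [V /(nbhd_basis_ball hCs)[N gN ->] <-] hb].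
exists N => // m m0; apply: (ball_prob_le_expR hCs hY gN _ _ hb) => //; lra.
Qed.

Lemma weak_LDP_lower G : F_C Cs G ->
  (ereal_sup (entropy P Cs Y @` tauC_interior Cs G) <= limn_einf (log_prob_seq P Y G))%E.
Proof.
move=> FG; apply: ge_ereal_sup => _ [x [V Vx VG] <-].
apply: (@le_trans _ _ (limn_einf (log_prob_seq P Y V))).
  by apply: ereal_inf_lbound; exists V.
apply: le_limn_einf => n; apply: le_log_prob_seq => //.
by apply: sub_sigma_algebra; exists x.
Qed.

Lemma prob_bigsetU_le (U : nat -> set X) m n (c : R) :
  (forall i, (i < n)%N -> F_C Cs (U i) /\ (P (mean_seq Y m @^-1` U i) <= c%:E)%E) ->
  F_C Cs (\big[setU/set0]_(i < n) U i) /\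
  (P (mean_seq Y m @^-1` \big[setU/set0]_(i < n) U i) <= (n%:R * c)%:E)%E.
Proof.
elim: n => [|n IH] h.
  rewrite big_ord0 preimage_set0 measure0 mul0r; split=> //.
  by case: (sigma_algebra_F_C Cs).
have [FV hV] := IH (fun i im => h i (ltnW im)); have [FU hU] := h n (leqnn _).
rewrite big_ord_recr /=; split; first exact: F_CU.
rewrite preimage_setU -natr1 mulrDl mul1r EFinD.
apply: le_trans (measureU2 _ (measurable_mean _ FV) (measurable_mean _ FU)) _.
exact: leeD.
Qed.

Lemma sub_tauC_closure A : A `<=` tauC_closure Cs A.
Proof.
move=> x Ax V /(nbhd_basis_ball hCs)[N [sN _ _] ->]; exists x; split=> //=.
by rewrite subrr (sublinear0 (seminorm_sublinear sN)).
Qed.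

(** Each point of the closure has a ball whose probability is at most [expR b1 ^+ m] for all [m]. A
    finite subcover costs a factor equal to its cardinality, absorbed for large [m] by raising the
    rate from [b1] to [b]. *)
Lemma weak_LDP_upper K : F_C Cs K -> tauC_compact Cs (tauC_closure Cs K) ->
  (limn_esup (log_prob_seq P Y K) <= ereal_sup (entropy P Cs Y @` tauC_closure Cs K))%E.
Proof.
move=> FK cK; apply: le_ereal_real => b /lt_ereal_real[b1 [Sb1]].
rewrite lte_fin => b1b.
pose O := [set U | [/\ tauC_open Cs U, F_C Cs U & forall m, (0 < m)%N ->
  (P (mean_seq Y m @^-1` U) <= (expR b1 ^+ m)%:E)%E]].
have [||n [U [OU KU]]] := cK O.
- by move=> U [].
- move=> x Kx; have [|N gN hN] := @entropy_lt x b1.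
    by apply: le_lt_trans Sb1; apply: ereal_sup_ubound; exists x.
  have half0 : 0 < 1 / 2 :> R by lra.
  exists [set y | N (y - x) < 1 / 2]; last first.
    by case: gN => sN _ _; rewrite /= subrr (sublinear0 (seminorm_sublinear sN)).
  split; [exact: tauC_open_ball|exact: F_C_ball|move=> m m0].
  have := hN m m0; rewrite -lee_fin /ball_prob fineK// fin_num_measure//.
  by apply: measurable_mean; exact: F_C_ball.
have b0 : 0 < b - b1 by rewrite subr_gt0.
apply: (@limn_esup_le _ _ _ (Num.truncn (n%:R / (b - b1))).+1) => m nm.
have m0 : (0 < m)%N by exact: leq_ltn_trans nm.
have [FU hU] : F_C Cs (\big[setU/set0]_(i < n) U i) /\
    (P (mean_seq Y m @^-1` \big[setU/set0]_(i < n) U i) <= (n%:R * expR b1 ^+ m)%:E)%E.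
  by apply: prob_bigsetU_le => i /OU[_ FU hU]; split=> //; exact: hU.
apply: log_rate_le => //.
apply: (@le_trans _ _ (P (mean_seq Y m @^-1` \big[setU/set0]_(i < n) U i))).
  apply: le_measure; rewrite ?inE; [exact: measurable_mean|exact: measurable_mean|].
  by move=> w /= /sub_tauC_closure/KU; rewrite -bigcup_mkord.
apply: le_trans hU _; rewrite lee_fin.
have -> : m%:R * b = m%:R * (b - b1) + m%:R * b1 by ring.
rewrite expRD -expRM_natl ler_wpM2r ?expR_ge0//.
apply: le_trans (expR_ge1Dx _); apply: (@le_trans _ _ (m%:R * (b - b1))); last by lra.
by rewrite -ler_pdivrMr//; apply/ltW/(lt_le_trans (truncnS_gt _)); rewrite ler_nat.
Qed.

Lemma dual_space0 : dual_space Cs (fun=> 0 : R).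
Proof.
split=> [a x y|U _ x Ux]; first by rewrite mulr0 addr0.
(* The empty intersection: the whole space is a basic neighbourhood. *)
exists (translate_set x (\bigcap_(i in `I_0) scale_set 1 set0)); last by [].
by exists 0%N, (fun=> set0), (fun=> 1).
Qed.

Lemma legendre_ge0 x : (0 <= legendre P Cs Y x)%E.
Proof.
apply: ereal_sup_ubound; exists (fun=> 0); first exact: dual_space0.
rewrite /logmgf; under eq_integral => w _ do rewrite expR0.
by rewrite integral_cst// mul1e [X in lne X](probability_setT P) lne1 sube0.
Qed.

(** Chernoff's bound for each [lam], on a ball small enough that the oscillation of [lam] costs at
    most [eps]. *)
Lemma entropy_le_legendre x : (entropy P Cs Y x <= - legendre P Cs Y x)%E.
Proof.
rewrite leeNr; apply: ge_ereal_sup => _ [lam dlam <-].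
have [N gN lamN] := dual_spaceP hCs dlam.
(* The moment may be infinite, so the comparison is made with every real [b] above
   [p lam - lam x]. *)
rewrite leeNr oppeB ?fin_num_adde_defr//; apply: le_ereal_real => b hb.
have {}hb : (logmgf P Y lam < (b + lam x)%:E)%E.
  by move: hb; rewrite addeC lteBlDr// EFinD.
have Ib : (\int[P]_w (expR (lam (Y 0%N w)))%:E <= (expR (b + lam x))%:E)%E.
  rewrite leNgt; apply/negP => /ltW hI; move: hb; rewrite ltNge => /negP; apply.
  by rewrite /logmgf -lne_expR; apply: lne_le_mono.
apply/lee_addgt0Pr => eps eps0; pose t := eps / 3.
have t0 : 0 < t by rewrite divr_gt0.
have FB : F_C Cs [set y | N (y - x) < t] by exact: F_C_ball.
apply: (@le_trans _ _ (limn_einf (log_prob_seq P Y [set y | N (y - x) < t]))).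
  apply: ereal_inf_lbound; exists [set y | N (y - x) < t] => //.
  by case: gN => _ _; apply.
apply: le_trans (limn_einf_sup _) _; apply: (@limn_esup_le _ _ _ 1) => m m0.
apply: log_rate_le => //.
have := ball_prob_chernoff hCs hY gN lamN m0 t0 Ib.
rewrite -lee_fin /ball_prob fineK; last by rewrite fin_num_measure//; exact: measurable_mean.
by rewrite -expRM_natl (_ : 3 * t = eps)// /t; field.
Qed.

(** For [b] above the entropy, the sharpness of Chernoff's bound with [a = - b] gives a form with
    [lam x - p lam >= - b - eps]. *)
Lemma legendre_le_entropy x : (- legendre P Cs Y x <= entropy P Cs Y x)%E.
Proof.
apply: le_ereal_real => b1 /lt_ereal_real[b [hb bb1]].
have [N gN hN] := entropy_lt hb.
rewrite leeNl; apply: le_trans (_ : (- b)%:E <= _)%E; first by rewrite lee_fin lerN2 -lee_fin ltW.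
(* The sharpness result requires a positive [a]; for [b >= 0] the zero form is enough. *)
have [b0|b0] := leP 0 b.
  by apply: le_trans (legendre_ge0 x); rewrite lee_fin oppr_le0.
apply/lee_subgt0Pr => eps eps0.
have half0 : 0 < 1 / 2 :> R by lra.
have a0 : 0 < - b by rewrite oppr_gt0.
have [|lam dlam hlam] := exists_dual_expectation_le hCs hY gN (x := x) a0 half0 eps0.
  by move=> m m0; rewrite opprK; exact: hN.
apply: (@le_trans _ _ ((lam x)%:E - logmgf P Y lam)%E); last first.
  by apply: ereal_sup_ubound; exists lam.
have : (logmgf P Y lam <= (lam x - - b + eps)%:E)%E.
  rewrite -lne_expR; apply: lne_le_mono => //.
  by apply: integral_ge0 => w _; rewrite lee_fin expR_ge0.
move=> h; apply: (@le_trans _ _ ((lam x)%:E - (lam x - - b + eps)%:E)%E).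
  by rewrite -!EFinB lee_fin; lra.
exact: leeB.
Qed.

End LargeDeviations.

Theorem theorem4p5 (R : realType) (X : lmodType R) (Cs : set (set X))
  (hCs : forall C, Cs C ->
     [/\ symmetric_set C, algebraically_open C, is_convex_set C, C 0 & tau_separable C])
  (d : measure_display) (Omega : measurableType d) (P : probability Omega R)
  (Y : nat -> Omega -> X) (hY : iid P (F_C Cs) Y) :
  weak_LDP P Cs Y /\ (forall x : X, entropy P Cs Y x = (- legendre P Cs Y x)%E).
Proof.
split; first by split; [exact: weak_LDP_lower|exact: weak_LDP_upper].
move=> x; apply/eqP; rewrite eq_le; apply/andP; split.
  exact: entropy_le_legendre.
exact: legendre_le_entropy.
Qed.
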